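(* Let $(\mathcal K,\leqslant)$ be a smooth class of finite $\mathfrak L$-structures (finite relational language $\mathfrak L$) with the hereditary property and the $\leqslant$-amalgamation property, and let $\mathbf M$ be the $(\mathcal K,\leqslant)$-generic structure. Then the following are equivalent: (1) $\mathrm{Aut}(\mathbf M)$ has the convex $\leqslant$-Ramsey property with respect to $(\mathcal K,\leqslant)$; (2) for all $A,B\in\mathcal K$ with $A\leqslant B$ there is $C\in\mathcal K$ with $B\leqslant C$ such that for every $f:\binom{C}{A}\to\{0,1\}$ there is $\mathtt p\in\langle{C\atop B}\rangle$ with $|f(\mathtt q_1)-f(\mathtt q_2)|\leq\frac12$ for all $\mathtt q_1,\mathtt q_2\in\langle{\mathtt p\atop A}\rangle$; (3) for all $A,B\in\mathcal K$ with $A\leqslant B$ and every $\epsilon>0$ there is $C\in\mathcal K$ with $B\leqslant C$ such that for every $f:\binom{C}{A}\to[0,1]$ there is $\mathtt p\in\langle{C\atop B}\rangle$ with $|f(\mathtt q_1)-f(\mathtt q_2)|\leq\epsilon$ for all $\mathtt q_1,\mathtt q_2\in\langle{\mathtt p\atop A}\rangle$; (4) for all $A,B\in\mathcal K$ with $A\leqslant B$, every $\epsilon>0$ and every $n\in\mathbb N$ there is $C\in\mathcal K$ with $B\leqslant C$ such that for every sequence of functions $f_i:\binom{C}{A}\to[0,1]$, $i<n$, there is $\mathtt p\in\langle{C\atop B}\rangle$ with $|f_i(\mathtt q_1)-f_i(\mathtt q_2)|\leq\epsilon$ for all $\mathtt q_1,\mathtt q_2\in\langle{\mathtt p\atop A}\rangle$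 and all $i<n$; (5) $\mathrm{Aut}(\mathbf M)$ (with the pointwise convergence topology) is amenable.
   Context: Smooth class $(\mathcal K,\leqslant)$: $\mathcal K$ a class of finite $\mathfrak L$-structures closed under isomorphism and substructures, containing $\emptyset$; $\leqslant$ a reflexive transitive relation between pairs $A\subseteq B$ in $\mathcal K$, invariant under embeddings, with (i) $\emptyset\leqslant A$; (ii) $A\subseteq B'\subseteq B$, $A\leqslant B$ imply $A\leqslant B'$; (iii) $A_1,A_2\subseteq A$, $A_1\leqslant A$ imply $A_1\cap A_2\leqslant A_2$. For infinite $N$, $A\leqslant N$ means $A\leqslant B$ for all finite substructures $B\supseteq A$ of $N$. $\binom{N}{A}$ is the set of embeddings $\Gamma$ of $A$ into $N$ with $\Gamma[A]\leqslant N$. Hereditary property: closure under substructures; $\leqslant$-amalgamation: for $\leqslant$-embeddings $\gamma_1:A\to B,\gamma_2:A\to C$ there are $D\in\mathcal K$ and $\leqslant$-embeddings $\lambda_1:B\to D,\lambda_2:C\to D$ with $\lambda_1\gamma_1=\lambda_2\gamma_2$. The generic $\mathbf M$ is the unique countable structure with $\mathrm{Age}(\mathbf M)=\mathcal K$, $\mathbf M=\bigcup_i A_i$, $A_i\in\mathcal K$, $A_i\leqslant A_{i+1}$, such that if finite $A\leqslant\mathbf M$ and $A\leqslant B\in\mathcal K$ then some embedding $\Gamma:B\to\mathbf M$ fixes $A$ pointwise with $\Gamma[B]\leqslant\mathbf M$. For $A\in\mathcal K$ and $N$ a structure (finite in $\mathcal K$, or $\mathbf M$), $\langle{N\atop A}\rangle$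 is the set of finitely supported probability measures on $\binom{N}{A}$. For $A\leqslant B$ in $\mathcal K$ and $\mathtt r\in\langle{N\atop B}\rangle$, $\langle{\mathtt r\atop A}\rangle$ is the set of $\mathtt q\in\langle{N\atop A}\rangle$ for which there exists $\mathtt p'\in\langle{B\atop A}\rangle$ with $\mathtt q(\Lambda\circ\Gamma)=\mathtt r(\Lambda)\cdot\mathtt p'(\Gamma)$ for all $\Gamma\in\binom{B}{A}$ and $\Lambda\in\binom{N}{B}$. For a function $f$ on $\binom{N}{A}$ and $\mathtt q\in\langle{N\atop A}\rangle$, $f(\mathtt q)=\sum_{\Gamma}f(\Gamma)\mathtt q(\Gamma)$. $\mathrm{Aut}(\mathbf M)$ has the convex $\leqslant$-Ramsey property with respect to $(\mathcal K,\leqslant)$ if for all $A\leqslant B$ in $\mathcal K$ and every $f:\binom{\mathbf M}{A}\to\{0,1\}$ there is $\mathtt p\in\langle{\mathbf M\atop B}\rangle$ with $|f(\mathtt q_1)-f(\mathtt q_2)|\leq\frac12$ for all $\mathtt q_1,\mathtt q_2\in\langle{\mathtt p\atop A}\rangle$. A topological group is amenable if every continuous action on a compact Hausdorff space admits an invariant Borel probability measure.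
   Formalization: Membership of q in ⟨r over A⟩ is taken as q(Δ)=Σ r(Λ)p'(Γ) over all pairs with Λ∘Γ=Δ; the pairwise equation q(Λ∘Γ)=r(Λ)p'(Γ) would make (1) vacuous (e.g. for finite posets) while (5) fails. *)

(* Defs.v *)
From HB Require Import structures.
From mathcomp Require Import all_boot all_order all_algebra.
From mathcomp Require Import all_classical all_reals all_analysis.

Set Implicit Arguments.
Unset Strict Implicit.
Unset Printing Implicit Defensive.

Import Order.TTheory GRing.Theory Num.Theory.
Import numFieldNormedType.Exports.

Local Open Scope classical_set_scope.
Local Open Scope ring_scope.

(* Arities are positive, so that there is exactly one empty structure. *)
Record language := Language {
  symbol :> finType;
  arity : symbol -> nat;
  arity_gt0 : forall s, (0 < arity s)%N
}.

(* A choiceType carrier is no restriction: with the choice axiom of boolp every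
   type is a choiceType. *)
Record structure (L : language) := Structure {
  carrier :> choiceType;
  interp : forall s : L, set ((arity s).-tuple carrier)
}.

Section structures.
Variable L : language.
Implicit Types A B C N M : structure L.

Definition finite_structure A := finite_set [set: A].

Definition empty_structure : structure L :=
  @Structure L void (fun _ => set0).

Definition substructure N (X : set N) : structure L :=
  @Structure L X (fun s => [set t | interp (map_tuple val t : _.-tuple N)]).

Definition embedding A N (f : A -> N) :=
  injective f /\
  forall (s : L) (t : (arity s).-tuple A),
    interp t <-> interp (map_tuple f t).

Definition isomorphism A B (f : A -> B) := bijective f /\ embedding f.

Definition isomorphic A B := exists f : A -> B, isomorphism f.

Definition hereditary (K : structure L -> Prop) :=
  forall B (X : set B), K B -> K (substructure X).

End structures.

Arguments substructure {L N} X.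

(* [sc_le B X] says that the substructure of B with universe X is a
   [<=]-substructure of B. For nested X `<=` Y `<=` B, the assertion X <= Y is
   [sc_le (substructure Y) (val @^-1` X)]. *)
Unset Implicit Arguments.
Record smooth_class (L : language) := SmoothClass {
  sc_mem :> structure L -> Prop;
  sc_le : forall B : structure L, set B -> Prop;
  sc_finite : forall A, sc_mem A -> finite_structure A;
  sc_iso : forall A B, isomorphic A B -> sc_mem A -> sc_mem B;
  sc_hereditary : hereditary sc_mem;
  sc_empty : sc_mem (empty_structure L);
  sc_le_mem : forall (B : structure L) (X : set B), sc_le B X -> sc_mem B;
  sc_le_iso : forall (B B' : structure L) (f : B -> B') (X : set B),
    isomorphism f -> sc_le B X -> sc_le B' (f @` X);
  sc_le_refl : forall B : structure L, sc_mem B -> sc_le B setT;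
  sc_le_trans : forall (B : structure L) (X Y : set B), X `<=` Y ->
    sc_le (substructure Y) (val @^-1` X) -> sc_le B Y -> sc_le B X;
  sc_le_empty : forall B : structure L, sc_mem B -> sc_le B set0;
  sc_le_sub : forall (B : structure L) (X Y : set B), X `<=` Y ->
    sc_le B X -> sc_le (substructure Y) (val @^-1` X);
  sc_le_cap : forall (B : structure L) (X Y : set B),
    sc_le B X -> sc_le (substructure Y) (val @^-1` (X `&` Y))
}.

Set Implicit Arguments.

Arguments sc_mem {L} K A : rename.
Arguments sc_le {L} K B X : rename.
Arguments sc_finite {L} K {A} : rename.
Arguments sc_iso {L} K {A B} : rename.
Arguments sc_hereditary {L} K : rename.
Arguments sc_empty {L} K : rename.
Arguments sc_le_mem {L} K {B X} : rename.
Arguments sc_le_iso {L} K {B B' f X} : rename.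
Arguments sc_le_refl {L} K {B} : rename.
Arguments sc_le_trans {L} K {B X Y} : rename.
Arguments sc_le_empty {L} K {B} : rename.
Arguments sc_le_sub {L} K {B X Y} : rename.
Arguments sc_le_cap {L} K {B X} Y : rename.

Section smooth.
Variables (L : language) (K : smooth_class L).
Implicit Types A B C D N M : structure L.

(* X <= N for finite X `<=` N and an arbitrary structure N; when N is in K this
   is the relation of the smooth class itself, see [strongE]. *)
Definition strong N (X : set N) :=
  finite_set X /\
  forall Y : set N, finite_set Y -> X `<=` Y ->
    sc_le K (substructure Y) (val @^-1` X).

Lemma substructureT_iso N :
  isomorphism (val : substructure [set: N] -> N).
Proof.
split; last by split; [exact: val_inj | move=> s t].
exists (fun x : N => SigSub (mem_set (I : [set: N] x)) : substructure [set: N]).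
  by move=> x; exact: val_inj.
by [].
Qed.

Lemma strongE N (X : set N) : K N -> strong X <-> sc_le K N X.
Proof.
move=> KN; have finN := sc_finite K KN; split=> [[_ sX]|sX].
  have := sc_le_iso K (substructureT_iso N) (sX setT finN (@subsetT _ _)).
  suff -> : val @` (val @^-1` X : set (substructure [set: N])) = X by [].
  apply/seteqP; split=> [_ [y Xy <-] //|x Xx].
  by exists (SigSub (mem_set (I : [set: N] x))).
by split=> [|Y _ XY]; [exact: sub_finite_set finN | exact: sc_le_sub].
Qed.

(* $\binom{N}{A}$ *)
Definition binom N A : set (A -> N) :=
  [set G | embedding G /\ strong (range G)].
Arguments binom : clear implicits.

(* A <= B for structures A and B, read up to the renaming of elements that makes
   A a subset of B; K is closed under isomorphism. *)
Definition leqK A B := binom B A !=set0.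

Definition amalgamation :=
  forall A B C (g1 : A -> B) (g2 : A -> C),
    K A -> K B -> K C -> binom B A g1 -> binom C A g2 ->
    exists D (l1 : B -> D) (l2 : C -> D),
      [/\ K D, binom D B l1, binom D C l2 & l1 \o g1 = l2 \o g2].

Definition has_age M :=
  forall A, K A <-> finite_structure A /\ exists f : A -> M, embedding f.

Definition union_of_chain M :=
  exists A_ : nat -> set M,
    [/\ forall i, K (substructure (A_ i)),
        forall i, A_ i `<=` A_ i.+1 /\
                  sc_le K (substructure (A_ i.+1)) (val @^-1` A_ i)
      & \bigcup_i A_ i = setT].

Definition rich M :=
  forall (X : set M) B (g : substructure X -> B),
    strong X -> K B -> binom B (substructure X) g ->
    exists2 G, binom M B G & G \o g = val.

Definition generic M :=
  [/\ countable [set: M], has_age M, union_of_chain M & rich M].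

Variable R : realType.

Definition fsprob (T : choiceType) (S : set T) : set (T -> R) :=
  [set p | [/\ forall x, 0 <= p x,
               finite_set [set x | p x != 0],
               [set x | p x != 0] `<=` S
             & \sum_(x \in S) p x = 1]].

(* $\langle{N\atop A}\rangle$ *)
Definition measures N A : set ((A -> N) -> R) := fsprob (binom N A).
Arguments measures : clear implicits.

(* The measure q with $q(\Lambda\circ\Gamma) = r(\Lambda)p'(\Gamma)$, read as the
   image of the product measure under composition: when distinct pairs have
   the same composite, their products add up. Read pairwise, the equation
   would in general have no solution q: r is finitely supported, while an
   element of binom(N, A) can have infinitely many factorizations. *)
Definition comp_measure N B A (r : (B -> N) -> R) (p' : (A -> B) -> R)
    (H : A -> N) : R :=
  \sum_(x \in [set x : (B -> N) * (A -> B) |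
                 [/\ binom N B x.1, binom B A x.2 & x.1 \o x.2 = H]])
     r x.1 * p' x.2.

(* $\langle{r\atop A}\rangle$ *)
Definition sub_measures N B (r : (B -> N) -> R) A : set ((A -> N) -> R) :=
  [set q | measures N A q /\
           exists2 p', measures B A p' & forall H : A -> N, q H = comp_measure r p' H].
Arguments sub_measures {N B} r A.

(* $f(q)$; f is a function on binom(N, A), its values elsewhere are ignored. *)
Definition mean N A (f q : (A -> N) -> R) : R :=
  \sum_(G \in binom N A) f G * q G.

Definition oscillation_le N B A (f : (A -> N) -> R) (p : (B -> N) -> R) (e : R) :=
  forall q1 q2, sub_measures p A q1 -> sub_measures p A q2 ->
    `|mean f q1 - mean f q2| <= e.

Definition convex_Ramsey M :=
  forall A B, K A -> K B -> leqK A B ->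
  forall f : (A -> M) -> R, (forall G, binom M A G -> f G = 0 \/ f G = 1) ->
  exists2 p, measures M B p & oscillation_le f p (1 / 2).

End smooth.

Arguments binom {L} K N A.
Arguments leqK {L} K A B.
Arguments measures {L} K {R} N A.
Arguments sub_measures {L} K {R N B} r A.
Arguments oscillation_le {L} K {R N B A} f p e.
Arguments convex_Ramsey {L} K R M.

HB.mixin Record isTopologicalGroup G of Group G & Topological G := {
  mulg_continuous : continuous (fun x : G * G => (x.1 * x.2)%g);
  invg_continuous : continuous (fun x : G => (x^-1)%g)
}.

#[short(type="topologicalGroupType")]
HB.structure Definition TopologicalGroup :=
  {G of Group G & Topological G & isTopologicalGroup G}.

Definition continuous_action (G : topologicalGroupType) (X : topologicalType)
    (a : G -> X -> X) :=
  [/\ forall x, a 1%g x = x,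
      forall g h x, a (g * h)%g x = a g (a h x)
    & continuous (fun y : G * X => a y.1 y.2)].

(* X is pointed because the empty space carries no probability measure. *)
Definition amenable (R : realType) (G : topologicalGroupType) :=
  forall (X : ptopologicalType) (a : G -> X -> X),
    compact [set: X] -> hausdorff_space X -> continuous_action a ->
    exists mu : probability (g_sigma_algebraType (@open X)) R,
      forall g (U : set (g_sigma_algebraType (@open X))),
        measurable U -> mu (a g @^-1` U) = mu U.

Record Aut (L : language) (M : structure L) := Automorphism {
  aut_fun :> M -> M;
  aut_iso : isomorphism aut_fun
}.

Section Aut.
Variables (L : language) (M : structure L).
Implicit Types g h : Aut M.

HB.instance Definition _ := gen_eqMixin (Aut M).
HB.instance Definition _ := gen_choiceMixin (Aut M).

Lemma aut_ext g h : g =1 h -> g = h.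
Proof.
case: g h => [g gi] [h hi] /= /funext gh; rewrite gh in gi *.
by congr Automorphism; exact: Prop_irrelevance.
Qed.

Lemma id_isomorphism : isomorphism (@id M).
Proof.
split; first by exists id.
by split=> // s t; rewrite (_ : map_tuple _ t = t) //; apply: val_inj; exact: map_id.
Qed.

Lemma comp_isomorphism (f g : M -> M) :
  isomorphism f -> isomorphism g -> isomorphism (f \o g).
Proof.
move=> [fb [fi fr]] [gb [gi gr]]; split; first exact: bij_comp.
split=> [|s t]; first exact: inj_comp.
rewrite gr fr (_ : map_tuple (f \o g) t = map_tuple f (map_tuple g t)) //.
by apply: val_inj; exact: map_comp.
Qed.

Lemma can_isomorphism (f g : M -> M) :
  isomorphism f -> cancel f g -> cancel g f -> isomorphism g.
Proof.
move=> [_ [_ fr]] fK gK; split; first by exists f.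
split=> [|s t]; first exact: can_inj gK.
have := fr s (map_tuple g t).
rewrite (_ : map_tuple f (map_tuple g t) = t); first by case.
by apply: val_inj; rewrite /= -map_comp -[RHS]map_id; exact: eq_map.
Qed.

Lemma aut_invP g : {h : M -> M | cancel g h /\ cancel h g}.
Proof. by apply: cid; case: (aut_iso g) => -[h gK hK] _; exists h. Qed.

Definition aut_one : Aut M := Automorphism id_isomorphism.

Definition aut_mul g h : Aut M :=
  Automorphism (comp_isomorphism (aut_iso g) (aut_iso h)).

Definition aut_inv g : Aut M :=
  let hP := svalP (aut_invP g) in
  Automorphism (can_isomorphism (aut_iso g) hP.1 hP.2).

Fact aut_mulA : associative aut_mul.
Proof. by move=> f g h; exact: aut_ext. Qed.

Fact aut_mul1g : left_id aut_one aut_mul.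
Proof. by move=> g; exact: aut_ext. Qed.

Fact aut_mulg1 : right_id aut_one aut_mul.
Proof. by move=> g; exact: aut_ext. Qed.

Fact aut_mulVg : left_inverse aut_one aut_inv aut_mul.
Proof. by move=> g; apply: aut_ext => x; exact: (svalP (aut_invP g)).1. Qed.

Fact aut_mulgV : right_inverse aut_one aut_inv aut_mul.
Proof. by move=> g; apply: aut_ext => x; exact: (svalP (aut_invP g)).2. Qed.

HB.instance Definition _ := isGroup.Build (Aut M)
  aut_mulA aut_mul1g aut_mulg1 aut_mulVg aut_mulgV.

HB.instance Definition _ := Topological.copy (Aut M)
  (initial_topology
     (@aut_fun L M : Aut M -> {ptws M -> discrete_topology M})).

Lemma aut_cvgP (F : set_system (Aut M)) g : Filter F ->
  F --> g <-> forall x, F [set h : Aut M | h x = g x].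
Proof.
move=> FF.
have -> : F --> g <->
    ((@aut_fun L M : Aut M -> {ptws M -> discrete_topology M}) @ F)
      --> (g : {ptws M -> discrete_topology M}).
  split=> [Fg U Ug|Fg U].
    exact/Fg/(@initial_continuous (Aut M) {ptws M -> discrete_topology M}).
  rewrite nbhsE => -[_ [[V oV <-] Vg] VU].
  apply: filterS VU _; apply: Fg; exact: open_nbhs_nbhs.
have -> : ((@aut_fun L M : Aut M -> {ptws M -> discrete_topology M}) @ F)
      --> (g : {ptws M -> discrete_topology M}) <->
    forall x, ((fun h : Aut M => h x : discrete_topology M) @ F)
      --> (g x : discrete_topology M).
  split=> [Fg x|Fg].
    exact: (cvg_comp _ _ Fg
      (@proj_continuous M (fun=> discrete_topology M) x (g : _ -> _))).
  apply/cvg_sup => x U.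
  rewrite nbhsE => -[_ [[V oV <-] Vg] VU].
  by apply: filterS VU _; apply: (Fg x); exact: open_nbhs_nbhs.
split=> Fg x; first by have := Fg x; rewrite discrete_cvg.
by rewrite discrete_cvg; exact: Fg.
Qed.

Fact aut_mul_continuous : continuous (fun x : Aut M * Aut M => (x.1 * x.2)%g).
Proof.
case=> g h; apply/aut_cvgP => x.
have /aut_cvgP/(_ x) hx := @cvg_id _ (nbhs h).
have /aut_cvgP/(_ (h x)) gx := @cvg_id _ (nbhs g).
exists ([set k : Aut M | k (h x) = g (h x)], [set k : Aut M | k x = h x]).
  by split; [exact: gx | exact: hx].
by move=> -[g' h'] /= [eg eh]; rewrite eh.
Qed.

Fact aut_inv_continuous : continuous (fun g : Aut M => (g^-1)%g).
Proof.
move=> g.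
apply/(@aut_cvgP _ _ (fmap_filter _ (nbhs_filter (g : Aut M)))) => x.
have /aut_cvgP/(_ (g^-1%g x)) gx := @cvg_id _ (nbhs g).
apply: (@filterS _ _ (nbhs_filter (g : Aut M)) _ _ _ gx) => h /= hx.
apply: (bij_inj (aut_iso h).1).
have gVK (f : Aut M) y : f ((f^-1)%g y) = y by exact: (svalP (aut_invP f)).2.
by rewrite hx !gVK.
Qed.

HB.instance Definition _ := isTopologicalGroup.Build (Aut M)
  aut_mul_continuous aut_inv_continuous.

End Aut.

(* Main.v *)
(** A finitely supported probability is handled as the mean [phi |-> sum_i w_i phi(x_i)]
that it defines. By convexity, the oscillation condition only has to be tested on Dirac
measures: it says that [G |-> mean of f(L o G)] is almost constant on the finite set
[binom(B, A)].

(1) => (2) is a compactness argument along the chain exhausting [M]. (2) => (3): splitting a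
function at half of its range turns the bound 1/2 for two-valued functions into a contraction
of oscillations by 3/4, which is iterated; (3) => (4) treats the functions one after the other,
averaging being harmless for those already treated.

(4) => (5): [M] is homogeneous (back and forth), so that [binom(M, A)] is the quotient of
[Aut(M)] by the pointwise stabilizer of [A]. For [f] continuous on a compact [Aut(M)]-space,
[h |-> f(h^-1 x)] is almost a function on such a quotient, and (4) yields finitely supported
measures on the orbit of [x] which are almost invariant for finitely many group elements and
continuous functions. Their limit along an ultrafilter is a finitely additive probability on all
subsets, invariant on continuous functions; inner regularization by closed sets followed by
outer regularization by open sets gives an outer measure whose restriction to Borel sets is an
invariant probability.

(5) => (1): apply amenability to the closure of the orbit of [f] in [{0,1}^(A -> M)]. The
invariant measure gives the same mass to all the cylinders [{y | y(H) = 1}], [H] in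
[binom(M, A)]; its projection to the coordinates coming from a copy of [B] is an average of
translates of [f], hence a [p] whose oscillation is zero. *)

Require Import Defs.
From HB Require Import structures.
From mathcomp Require Import all_boot all_order all_algebra.
From mathcomp Require Import all_classical all_reals all_analysis.
From mathcomp Require Import finmap lra.

Set Implicit Arguments.
Unset Strict Implicit.
Unset Printing Implicit Defensive.

Import Order.TTheory GRing.Theory Num.Theory.
Import numFieldNormedType.Exports.

Local Open Scope classical_set_scope.
Local Open Scope ring_scope.

(** * Finitely supported means *)

Section finite_means.
Variable R : realType.

(** The points [x i] may repeat, so that images and products of means need no merging of weights,
    and [T] no decidable equality. *)
Definition fsmeans (T : Type) (S : set T) : set ((T -> R) -> R) :=
  [set m | exists (I : finType) (w : I -> R) (x : I -> T),
     [/\ forall i, 0 <= w i, \sum_i w i = 1, forall i, S (x i) &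
         forall phi, m phi = \sum_i w i * phi (x i)]].

Lemma fsmean_dirac (T : Type) (S : set T) (x : T) :
  S x -> fsmeans S (fun phi => phi x).
Proof.
move=> Sx; exists unit, (fun=> 1), (fun=> x).
by split=> // [|phi]; rewrite big_const card_unit /= ?mul1r addr0.
Qed.

Lemma fsmean_le (T : Type) (S : set T) m (f g : T -> R) :
  fsmeans S m -> (forall x, S x -> f x <= g x) -> m f <= m g.
Proof.
move=> [I [w [x [w0 w1 Sx mE]]]] fg; rewrite !mE.
by apply: ler_sum => i _; apply: ler_wpM2l; [exact: w0 | exact/fg/Sx].
Qed.

Lemma fsmean_eq (T : Type) (S : set T) m (f g : T -> R) :
  fsmeans S m -> (forall x, S x -> f x = g x) -> m f = m g.
Proof.
move=> mS fg; apply/eqP; rewrite eq_le.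
by rewrite !(fsmean_le mS)// => x /fg ->.
Qed.

Lemma fsmeanD (T : Type) (S : set T) m (f g : T -> R) :
  fsmeans S m -> m (fun x => f x + g x) = m f + m g.
Proof.
move=> [I [w [x [w0 w1 Sx mE]]]]; rewrite !mE -big_split/=.
by apply: eq_bigr => i _; rewrite mulrDr.
Qed.

Lemma fsmeanZ (T : Type) (S : set T) m c (f : T -> R) :
  fsmeans S m -> m (fun x => c * f x) = c * m f.
Proof.
move=> [I [w [x [w0 w1 Sx mE]]]]; rewrite !mE mulr_sumr.
by apply: eq_bigr => i _; rewrite mulrCA.
Qed.

Lemma fsmeanB (T : Type) (S : set T) m (f g : T -> R) :
  fsmeans S m -> m (fun x => f x - g x) = m f - m g.
Proof.
move=> mS; rewrite (fsmeanD _ (fun x => - g x) mS); congr (_ + _).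
rewrite -mulN1r -(fsmeanZ _ _ mS).
by apply: (fsmean_eq mS) => x _; rewrite mulN1r.
Qed.

Lemma fsmean_cst (T : Type) (S : set T) m (c : R) :
  fsmeans S m -> m (fun=> c) = c.
Proof.
by move=> [I [w [x [w0 w1 Sx mE]]]]; rewrite mE -mulr_suml w1 mul1r.
Qed.

Lemma fsmean_norm_le (T : Type) (S : set T) m (f : T -> R) e :
  fsmeans S m -> (forall x, S x -> `|f x| <= e) -> `|m f| <= e.
Proof.
move=> mS fe; rewrite ler_norml.
rewrite -{1}(fsmean_cst (- e) mS) -{2}(fsmean_cst e mS).
by rewrite !(fsmean_le mS)// => x /fe; rewrite ler_norml => /andP[].
Qed.

Lemma fsmean_map (T U : Type) (S : set T) (S' : set U) m (h : T -> U) :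
  fsmeans S m -> (forall x, S x -> S' (h x)) ->
  fsmeans S' (fun phi => m (phi \o h)).
Proof.
move=> [I [w [x [w0 w1 Sx mE]]]] Sh; exists I, w, (h \o x); split=> //.
by move=> i; exact/Sh/Sx.
Qed.

(** The image of the product measure under [h]. With composition of embeddings as [h], it iterates
    averaging over copies. *)
Lemma fsmean_prod (T U V : Type) (S : set T) (S' : set U) (S'' : set V) m m'
    (h : T -> U -> V) :
  fsmeans S m -> fsmeans S' m' -> (forall x y, S x -> S' y -> S'' (h x y)) ->
  fsmeans S'' (fun phi => m (fun x => m' (fun y => phi (h x y)))).
Proof.
move=> [I [w [x [w0 w1 Sx mE]]]] [J [v [y [v0 v1 Sy m'E]]]] Sh.
exists (I * J)%type, (fun i => w i.1 * v i.2), (fun i => h (x i.1) (y i.2)).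
split=> [i||i|phi].
- exact: mulr_ge0.
- rewrite -(pair_bigA _ (fun i j => w i * v j))/= -w1.
  by apply: eq_bigr => i _; rewrite -mulr_sumr v1 mulr1.
- exact: Sh.
- rewrite mE -(pair_bigA _ (fun i j => w i * v j * phi (h (x i) (y j))))/=.
  apply: eq_bigr => i _; rewrite m'E mulr_sumr.
  by apply: eq_bigr => j _; rewrite mulrA.
Qed.

Lemma fsbig_seq_support (T : choiceType) (S : set T) (r : seq T) (f : T -> R) :
  uniq r -> (forall x, x \in r -> S x) ->
  (forall x, S x -> x \notin r -> f x = 0) ->
  \sum_(x \in S) f x = \sum_(x <- r) f x.
Proof.
move=> ur rS f0; rewrite (fsbigE r)// big_seq_cond [RHS]big_seq.
by apply: eq_bigl => x; case: (boolP (x \in r)) => //= /rS/mem_set ->.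
Qed.

Lemma fsprob_seq (T : choiceType) (S : set T) (p : T -> R) :
  fsprob S p -> exists r : seq T, [/\ uniq r, forall x, x \in r -> S x &
    forall x, x \notin r -> p x = 0].
Proof.
move=> [p0 fp pS p1]; exists (fset_set [set x | p x != 0]).
have FE x : (x \in fset_set [set x | p x != 0]) = (p x != 0).
  by rewrite in_fset_set//; apply/idP/idP => [/set_mem//|?]; exact/mem_set.
split=> [|x|x]; [exact: fset_uniq|by rewrite FE => /pS|].
by rewrite FE negbK => /eqP.
Qed.

Lemma fsprob_fsmean (T : choiceType) (S : set T) (p : T -> R) :
  fsprob S p -> fsmeans S (fun phi => \sum_(x \in S) p x * phi x).
Proof.
move=> pP; have [r [ur rS r0]] := fsprob_seq pP; have [p0 _ _ p1] := pP.
have sumE phi : \sum_(x \in S) p x * phi x = \sum_(x <- r) p x * phi x.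
  by apply: fsbig_seq_support => // x _ /r0 ->; rewrite mul0r.
exists 'I_(size r), (fun i => p (tnth (in_tuple r) i)), (tnth (in_tuple r)).
split=> [i||i|phi]; [exact: p0| |exact/rS/mem_tnth|].
- rewrite -(big_tnth _ _ _ xpredT p) -p1; apply/esym.
  by apply: fsbig_seq_support => // x _ /r0.
- by rewrite sumE (big_tnth _ _ _ xpredT).
Qed.

Lemma fsmean_fsprob (T : choiceType) (S : set T) m :
  fsmeans S m -> exists2 p : T -> R, fsprob S p &
    forall phi, \sum_(x \in S) p x * phi x = m phi.
Proof.
move=> [I [w [y [w0 w1 Sy mE]]]].
pose p x := \sum_(i | y i == x) w i.
have p0 x : 0 <= p x by apply: sumr_ge0.
have supp : [set x | p x != 0] `<=` range y.
  move=> x /=; apply: contra_neqP => nx; rewrite /p big_pred0// => i.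
  by apply/negbTE/eqP => yx; apply: nx; exists i.
have fsupp : finite_set [set x | p x != 0].
  apply: sub_finite_set supp _; exact/finite_image/finite_finset.
have sS : [set x | p x != 0] `<=` S by move=> x /supp[i _ <-].
pose F := fset_set (range y).
have fy : finite_set (range y) by exact/finite_image/finite_finset.
have FE x : (x \in F) = (x \in range y) by rewrite in_fset_set.
have sumE phi : \sum_(x \in S) p x * phi x = m phi.
  rewrite (@fsbig_seq_support _ _ F) ?fset_uniq//; last 2 first.
  - by move=> x /=; rewrite FE => /set_mem[i _ <-].
  - move=> x _; rewrite FE => /negP xF.
    apply/eqP; rewrite mulf_eq0; apply/orP; left.
    by apply: contra_notT xF => px; exact/mem_set/supp.
  rewrite mE; under eq_bigr do rewrite /p mulr_suml big_mkcond.
  rewrite exchange_big/=; apply: eq_bigr => i _.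
  rewrite (bigD1_seq (y i)) ?fset_uniq//=; last first.
    by rewrite FE; apply/mem_set; exists i.
  by rewrite eqxx big1 ?addr0// => x; rewrite eq_sym => /negbTE ->.
exists p => //; split=> //.
rewrite -[RHS]w1 -[in RHS](eq_bigr _ (fun i _ => mulr1 (w i))) -(mE (fun=> 1)).
by rewrite -sumE; under [in RHS]eq_fsbigr do rewrite mulr1.
Qed.

End finite_means.

(** * Smooth classes *)

Section embeddings.
Variable L : language.
Implicit Types A B C D N : structure L.

Lemma embedding_comp A B C (f : B -> C) (g : A -> B) :
  embedding f -> embedding g -> embedding (f \o g).
Proof.
move=> [fi fr] [gi gr]; split=> [|s t]; first exact: inj_comp.
rewrite gr fr (_ : map_tuple (f \o g) t = map_tuple f (map_tuple g t)) //.
by apply: val_inj; exact: map_comp.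
Qed.

Lemma embedding_factor A B C (f : B -> C) (g : A -> B) :
  embedding f -> embedding (f \o g) -> embedding g.
Proof.
move=> [fi fr] [fgi fgr]; split=> [x y gxy|s t].
  by apply: fgi; rewrite /= gxy.
rewrite fgr fr (_ : map_tuple (f \o g) t = map_tuple f (map_tuple g t)) //.
by apply: val_inj; exact: map_comp.
Qed.

Lemma embedding_id A : embedding (@id A).
Proof.
split=> // s t; rewrite (_ : map_tuple _ t = t) //.
by apply: val_inj; exact: map_id.
Qed.

Lemma embedding_val N (Y : set N) : embedding (val : substructure Y -> N).
Proof. by split; [exact: val_inj | move=> s t]. Qed.

Lemma range_val N (Y : set N) : range (val : substructure Y -> N) = Y.
Proof.
apply/seteqP; split=> [_ [y _ <-]|x Yx]; first exact/set_mem/valP.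
by exists (SigSub (mem_set Yx)).
Qed.

Lemma corestrict A N (Y : set N) (f : A -> N) : range f `<=` Y ->
  exists f' : A -> substructure Y, val \o f' = f.
Proof.
move=> fY; exists (fun x => SigSub (mem_set (fY _ (imageT f x)))).
exact/funext.
Qed.

Lemma factor_same_range D D' N (e : D -> N) (e' : D' -> N) :
  embedding e -> embedding e' -> range e = range e' ->
  exists2 h : D -> D', isomorphism h & e' \o h = e.
Proof.
move=> ee ee' er.
have /choice[h hE] : forall d, exists d', e' d' = e d.
  by move=> d; have := imageT e d; rewrite er => -[d' _ <-]; exists d'.
have e'h : e' \o h = e by exact/funext.
have /choice[k kE] : forall d', exists d, e d = e' d'.
  by move=> d; have := imageT e' d; rewrite -er => -[d' _ <-]; exists d'.
exists h => //; split; last by apply: (embedding_factor ee'); rewrite e'h.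
exists k => x; first by apply: ee.1; rewrite kE hE.
by apply: ee'.1; rewrite hE kE.
Qed.

End embeddings.

Section strong.
Variables (L : language) (K : smooth_class L).
Implicit Types A B C D N : structure L.

(** Structures with the same range in [N] are isomorphic over [N], so the relation depends only on
    the two subsets of [N]. *)
Lemma sc_le_same_range D D' N (e : D -> N) (e' : D' -> N) (X : set N) :
  embedding e -> embedding e' -> range e = range e' ->
  sc_le K D (e @^-1` X) -> sc_le K D' (e' @^-1` X).
Proof.
move=> ee ee' er sX; have [h hi e'h] := factor_same_range ee ee' er.
have := sc_le_iso K hi sX; congr (sc_le K D' _).
case: hi => -[k hK kK] _; apply/seteqP; split=> [_ [d Xd <-]|d' Xd'].
  by rewrite /preimage/= -/((e' \o h) d) e'h.
by exists (k d') => //; rewrite /preimage/= -e'h /= kK.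
Qed.

(** The relation [<=] read between subsets of one ambient [N], where transitivity can be used
    without substructures of substructures. *)
Definition rle N (X Y : set N) := sc_le K (substructure Y) (val @^-1` X).

Lemma rleP D N (e : D -> N) (X : set N) : embedding e ->
  sc_le K D (e @^-1` X) <-> rle X (range e).
Proof.
move=> ee; split; apply: sc_le_same_range => //; rewrite ?range_val//;
  exact: embedding_val.
Qed.

Lemma rle_relative N (X Y Z : set N) : Y `<=` Z ->
  sc_le K (substructure (val @^-1` Y : set (substructure Z)))
    (val @^-1` (val @^-1` X)) <-> rle X Y.
Proof.
move=> YZ; set V := (val @^-1` Y : set (substructure Z)).
have ee : embedding ((val : substructure Z -> N) \o
    (val : substructure V -> substructure Z)).
  by apply: embedding_comp; exact: embedding_val.
have := rleP X ee; congr (_ <-> rle X _).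
apply/seteqP; split=> [_ [z _ <-]|y Yy]; first exact: (set_mem (valP z)).
pose z : substructure Z := SigSub (mem_set (YZ _ Yy)).
by exists (SigSub (mem_set (Yy : V z))).
Qed.

Lemma rle_trans N (X Y Z : set N) : X `<=` Y -> Y `<=` Z ->
  rle X Y -> rle Y Z -> rle X Z.
Proof.
move=> XY YZ rXY rYZ; apply: (sc_le_trans K _ _ rYZ); first by move=> z /XY.
exact/rle_relative.
Qed.

Lemma rle_sub N (X Y Z : set N) : X `<=` Y -> Y `<=` Z -> rle X Z -> rle X Y.
Proof.
move=> XY YZ rXZ; apply/(rle_relative X YZ).
by apply: (sc_le_sub K _ rXZ) => z /XY.
Qed.

Lemma rle_refl N (X : set N) : K (substructure X) -> rle X X.
Proof.
move=> KX; rewrite /rle (_ : _ @^-1` _ = setT); first exact: sc_le_refl.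
by apply/seteqP; split=> // x _; exact: (set_mem (valP x)).
Qed.

Lemma finite_substructure N (Y : set N) :
  finite_set Y -> finite_set [set: substructure Y].
Proof.
move=> fY; have -> : [set: substructure Y] = val @^-1` Y.
  by apply/seteqP; split=> // y _; exact: (set_mem (valP y)).
by apply: finite_preimage => // x y _ _; exact: val_inj.
Qed.

Lemma strong_preimage D N (e : D -> N) (X : set N) :
  embedding e -> strong K X -> X `<=` range e -> strong K (e @^-1` X).
Proof.
move=> ee [fX sX] Xe; split.
  by apply: finite_preimage => // x y _ _; exact: ee.1.
move=> Y fY XY.
have ev : embedding (e \o (val : substructure Y -> D)).
  exact: (embedding_comp ee (@embedding_val _ _ _)).
have := rleP X ev; rewrite /preimage/= => ->; apply: sX.
  exact/finite_image/finite_substructure.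
move=> x Xx; have [d _ dx] := Xe _ Xx.
have Yd : Y d by apply: XY; rewrite /preimage/= dx.
by exists (SigSub (mem_set Yd)).
Qed.

(** A finite [Y] containing the range of [l \o g] need not contain that of [l]. So [Y] is enlarged
    by [range l], transitivity goes through [range l], and the result is restricted to [Y]. *)
Lemma binom_comp A B N (l : B -> N) (g : A -> B) :
  binom K N B l -> binom K B A g -> binom K N A (l \o g).
Proof.
move=> [el [fl sl]] [eg [fg sg]]; have elg := embedding_comp el eg.
have lg_l : range (l \o g) `<=` range l by move=> _ [a _ <-]; exists (g a).
split=> //; split; first exact: sub_finite_set fl.
have fB : finite_set [set: B].
  have -> : [set: B] = l @^-1` range l by apply/seteqP; split=> // b _; exists b.
  by apply: finite_preimage fl => x y _ _; exact: el.1.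
move=> Y fY lgY.
have fZ : finite_set (Y `|` range l) by rewrite finite_setU.
apply: (rle_sub lgY (@subsetUl _ Y (range l))).
apply: (rle_trans lg_l); [exact: subsetUr| |exact/sl/subsetUr].
apply/(rleP _ el).
have := sg setT fB (@subsetT _ _); rewrite -/(rle (range g) setT).
rewrite -(_ : range (@id B) = setT); last by rewrite image_id.
move/(rleP _ (@embedding_id _ B)); congr (sc_le K B _).
apply/seteqP; split=> [_ [a _ <-]|b [a _ /el.1 <-]]; by exists a.
Qed.

Lemma binom_id B : K B -> binom K B B id.
Proof.
move=> KB; split; first exact: embedding_id.
by apply/strongE => //; rewrite image_id; exact: sc_le_refl.
Qed.

Lemma leqK_trans A B C : leqK K A B -> leqK K B C -> leqK K A C.
Proof. by move=> [g Bg] [l Cl]; exists (l \o g); exact: binom_comp Bg. Qed.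

(** Finite subsets of [D] become finite subsets of [N] through [e], so strength in [N] implies
    strength in [D]. This pulls embeddings into [M] back to finite substructures. *)
Lemma binom_factor A D N (e : D -> N) (g : A -> D) :
  embedding e -> binom K N A (e \o g) -> binom K D A g.
Proof.
move=> ee [eeg seg]; split; first exact: embedding_factor eeg.
have -> : range g = e @^-1` range (e \o g).
  by apply/seteqP; split=> [_ [a _ <-]|d [a _ /ee.1 <-]]; exists a.
by apply: strong_preimage => // _ [a _ <-]; exists (g a).
Qed.

Lemma binom_iso A N N' (h : N -> N') (g : A -> N) :
  isomorphism h -> binom K N A g -> binom K N' A (h \o g).
Proof.
move=> [[k hK kK] eh] bg; pose ek : N' -> N := k.
have ek_emb : embedding ek.
  apply: (embedding_factor eh); rewrite (_ : h \o ek = id) ?funeqE//.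
  exact: embedding_id.
apply: (binom_factor ek_emb); rewrite (_ : ek \o _ = g)//.
by apply/funext => a /=; rewrite /ek hK.
Qed.

Lemma finite_binom A B : K A -> K B -> finite_set (binom K B A).
Proof.
move=> /(sc_finite K) fA /(sc_finite K) fB.
pose FA := fset_set [set: A]; pose FB := fset_set [set: B].
have inA (a : A) : a \in FA by rewrite in_fset_set//; exact: mem_set.
have inB (b : B) : b \in FB by rewrite in_fset_set//; exact: mem_set.
pose ofF (phi : {ffun FA -> FB}) (a : A) : B := val (phi [` inA a]%fset).
apply: (@sub_finite_set _ _ (range ofF)); last first.
  exact/finite_image/finite_finset.
move=> g _; exists [ffun a => [` inB (g (val a))]%fset] => //.
by apply/funext => a; rewrite /ofF ffunE.
Qed.

End strong.

(** * Oscillation *)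

Section oscillation.
Variables (R : realType) (L : language) (K : smooth_class L).
Implicit Types A B C N : structure L.

Definition osc_le N B A (f : (A -> N) -> R) (m : ((B -> N) -> R) -> R) (e : R) :=
  forall g1 g2, binom K B A g1 -> binom K B A g2 ->
    `|m (fun l => f (l \o g1)) - m (fun l => f (l \o g2))| <= e.

Lemma mean_comp_measure N B A (f : (A -> N) -> R) p p' :
  measures K N B p -> measures K B A p' ->
  measures K N A (comp_measure K p p') /\
  mean K f (comp_measure K p p') =
    \sum_(l \in binom K N B) p l *
      (\sum_(g \in binom K B A) p' g * f (l \o g)).
Proof.
move=> mp mp'.
have [r [ur rS r0]] := fsprob_seq mp.
have [r' [ur' rS' r0']] := fsprob_seq mp'.
pose F := [seq (x, y) | x <- r, y <- r'].
have uF : uniq F by apply: allpairs_uniq => // -[? ?] [? ?].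
have FS x : x \in F -> binom K N B x.1 /\ binom K B A x.2.
  by case/allpairsP => -[a b] [/= /rS ? /rS' ? ->].
have F0 x : x \notin F -> p x.1 * p' x.2 = 0.
  move=> xF; have [x1|/r0 ->] := boolP (x.1 \in r); last by rewrite mul0r.
  have [x2|/r0' ->] := boolP (x.2 \in r'); last by rewrite mulr0.
  by move: xF; rewrite (surjective_pairing x) allpairs_f.
have qE H : comp_measure K p p' H =
    \sum_(x <- F) if x.1 \o x.2 == H then p x.1 * p' x.2 else 0.
  rewrite /comp_measure -big_mkcond/= -[RHS]big_filter. apply: fsbig_seq_support.
  - exact: filter_uniq.
  - by move=> x; rewrite mem_filter => /andP[/eqP <-] /FS[].
  - move=> x [_ _ /eqP xH]; rewrite mem_filter xH/=; exact: F0.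
(* Distinct pairs in [F] may have the same composite; listing the composites without repetition lets
   their products add up. *)
pose r'' := undup [seq x.1 \o x.2 | x <- F].
have r''S H : H \in r'' -> binom K N A H.
  by rewrite mem_undup => /mapP[x /FS[x1 x2] ->]; exact: binom_comp x2.
have q0 H : H \notin r'' -> comp_measure K p p' H = 0.
  rewrite mem_undup qE => Hr; rewrite big_seq big1// => x xF.
  by case: eqP => // xH; case/mapP: Hr; exists x.
have mE (h : (A -> N) -> R) : mean K h (comp_measure K p p') =
    \sum_(x <- F) p x.1 * p' x.2 * h (x.1 \o x.2).
  rewrite /mean (@fsbig_seq_support _ _ _ r'') ?undup_uniq//; last first.
    by move=> H _ /q0 ->; rewrite mulr0.
  under eq_bigr do rewrite qE mulr_sumr.
  rewrite exchange_big/= big_seq [RHS]big_seq; apply: eq_bigr => x xF.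
  have xr : x.1 \o x.2 \in r'' by rewrite mem_undup; apply/mapP; exists x.
  rewrite (bigD1_seq _ xr) ?undup_uniq//=.
  rewrite eqxx big1 ?addr0 1?mulrC// => H; rewrite eq_sym => /negbTE ->.
  by rewrite mulr0.
have {}mE h : mean K h (comp_measure K p p') = \sum_(l \in binom K N B) p l *
      (\sum_(g \in binom K B A) p' g * h (l \o g)).
  rewrite mE big_allpairs_dep/= (@fsbig_seq_support _ _ _ r)//; last first.
    by move=> x _ /r0 ->; rewrite mul0r.
  apply: eq_bigr => l _; rewrite (@fsbig_seq_support _ _ _ r')//; last first.
    by move=> x _ /r0' ->; rewrite mul0r.
  by rewrite mulr_sumr; apply: eq_bigr => g _; rewrite mulrA.
split=> //; split.
- move=> H; rewrite qE; apply: sumr_ge0 => x _; case: ifP => // _.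
  by apply: mulr_ge0; [case: mp | case: mp'].
- apply: (@sub_finite_set _ _ [set` r'']); last exact: finite_seq.
  by move=> H /=; apply: contraNT => /q0 ->.
- by move=> H /= qH; apply: r''S; apply: contraNT qH => /q0 ->.
(* Total mass one is the formula [mE] at the constant function 1. *)
- have := mE (fun=> 1); rewrite /mean.
  under eq_fsbigr do rewrite mul1r.
  move=> ->; case: mp' => _ _ _ p'1; case: mp => _ _ _ p1.
  rewrite -[RHS]p1; apply: eq_fsbigr => l _.
  under eq_fsbigr do rewrite mulr1.
  by rewrite p'1 mulr1.
Qed.

Lemma oscillation_leP N B A (f : (A -> N) -> R) p m e :
  measures K N B p ->
  (forall phi, \sum_(l \in binom K N B) p l * phi l = m phi) ->
  oscillation_le K f p e <-> osc_le f m e.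
Proof.
move=> mp pm.
have mS : fsmeans (binom K N B) m.
  have := fsprob_fsmean mp; congr (_ _).
  by apply/funext => phi; rewrite pm.
split=> [osc g1 g2 Bg1 Bg2|osc q1 q2].
  have dirac g : binom K B A g -> exists2 q, sub_measures K p A q &
      mean K f q = m (fun l => f (l \o g)).
    move=> Bg; have [p' mp' p'E] := fsmean_fsprob (@fsmean_dirac R _ _ _ Bg).
    have [mq qE] := mean_comp_measure f mp mp'.
    exists (comp_measure K p p'); first by split=> //; exists p'.
    rewrite qE pm; congr m; apply/funext => l.
    by rewrite (p'E (fun g => f (l \o g))).
  have [q1 sq1 <-] := dirac _ Bg1; have [q2 sq2 <-] := dirac _ Bg2.
  exact: osc.
move=> [mq1 [p1 mp1 q1E]] [mq2 [p2 mp2 q2E]].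
rewrite (_ : q1 = comp_measure K p p1); last exact/funext.
rewrite (_ : q2 = comp_measure K p p2); last exact/funext.
rewrite (mean_comp_measure f mp mp1).2 (mean_comp_measure f mp mp2).2 !pm.
set h := fun g : A -> B => m (fun l => f (l \o g)).
(* Exchanging the two finite averages turns both means into averages of the same function [h], whose
   values differ pairwise by at most [e]. *)
have swap p' : measures K B A p' -> exists2 m', fsmeans (binom K B A) m' &
    m (fun l => \sum_(g \in binom K B A) p' g * f (l \o g)) = m' h.
  move=> /fsprob_fsmean; set m' := (X in fsmeans _ X) => m'S; exists m' => //.
  case: mS => I [w [x [w0 w1 Sx mE]]]; case: (m'S) => J [v [y [v0 v1 Sy m'E]]].
  rewrite mE m'E /h; under [RHS]eq_bigr do rewrite mE mulr_sumr.
  rewrite exchange_big/=; apply: eq_bigr => i _.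
  rewrite -/(m' (fun g => f (x i \o g))) m'E mulr_sumr.
  by apply: eq_bigr => j _; rewrite mulrCA.
have [m1 m1S ->] := swap _ mp1; have [m2 m2S ->] := swap _ mp2.
rewrite -[m1 h - _](_ : m1 (fun g => h g - m2 h) = _); last first.
  by rewrite (fsmeanB _ _ m1S) (fsmean_cst _ m1S).
apply: (fsmean_norm_le m1S) => g1 Bg1.
rewrite -[h g1 - _](_ : m2 (fun g => h g1 - h g) = _); last first.
  by rewrite (fsmeanB _ _ m2S) (fsmean_cst _ m2S).
by apply: (fsmean_norm_le m2S) => g2 Bg2; exact: osc.
Qed.

Lemma ex_measureP N B A (I : Type) (f : I -> (A -> N) -> R) e :
  (exists2 p, measures K N B p & forall i, oscillation_le K (f i) p e) <->
  (exists2 m, fsmeans (binom K N B) m & forall i, osc_le (f i) m e).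
Proof.
split=> [[p mp osc]|[m mS osc]].
  exists (fun phi => \sum_(l \in binom K N B) p l * phi l).
    exact: fsprob_fsmean.
  by move=> i; apply/(oscillation_leP _ _ mp).
have [p mp pm] := fsmean_fsprob mS; exists p => // i.
exact/(oscillation_leP _ _ mp pm).
Qed.

Lemma ex_measure1P N B A (f : (A -> N) -> R) e :
  (exists2 p, measures K N B p & oscillation_le K f p e) <->
  (exists2 m, fsmeans (binom K N B) m & osc_le f m e).
Proof.
have H := @ex_measureP N B A unit (fun=> f) e.
split=> [[p mp op]|[m mS om]].
  have [m mS om] := H.1 (ex_intro2 _ _ p mp (fun=> op)).
  by exists m => //; exact: om.
have [p mp op] := H.2 (ex_intro2 _ _ m mS (fun=> om)).
by exists p => //; exact: op.
Qed.

End oscillation.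

(** * Contraction of oscillations and finite families of functions *)

Section finite_equivalences.
Variables (R : realType) (L : language) (K : smooth_class L).
Implicit Types A B C : structure L.

(** Quantifying over all [d] makes the property homogeneous, so that contraction factors multiply
    when structures are chained. *)
Definition contracts A B C (c : R) := forall (d : R) (f : (A -> C) -> R),
  (forall g1 g2, binom K C A g1 -> binom K C A g2 -> `|f g1 - f g2| <= d) ->
  exists2 m, fsmeans (binom K C B) m & osc_le K f m (c * d).

Lemma contracts_refl A B : K B -> contracts A B B 1.
Proof.
move=> KB d f fd; exists (fun phi => phi id).
  exact/fsmean_dirac/binom_id.
by move=> g1 g2 Bg1 Bg2; rewrite mul1r; exact: fd.
Qed.

(** Averaging over copies of [C] in [D] leaves a function on [binom K C A] of oscillation at most
    [c' * d], to which the contraction from [B] to [C] applies. *)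
Lemma contracts_trans A B C D c c' :
  contracts A B C c -> contracts A C D c' -> contracts A B D (c * c').
Proof.
move=> BC CD d f /CD[m1 m1S m1d].
have [m2 m2S m2d] := BC _ (fun g => m1 (fun l => f (l \o g))) m1d.
exists (fun phi => m2 (fun k => m1 (fun l => phi (l \o k)))).
  by apply: (fsmean_prod m2S m1S) => k l Ck Dl; exact: binom_comp Ck.
by move=> g1 g2 Bg1 Bg2; rewrite -mulrA; exact: m2d.
Qed.

(* With [f] valued in [[a, a + d]] and [g] the indicator of its upper half,
   [f - (d / 2) g] is valued in [[a, a + d / 2]]; so the bound 1/2 for [g]
   yields [d / 4 + d / 2] for [f]. *)
Lemma contracts_binary A B C : leqK K A C ->
  (forall f : (A -> C) -> R,
    (forall G, binom K C A G -> f G = 0 \/ f G = 1) ->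
    exists2 p, measures K C B p & oscillation_le K f p (1 / 2)) ->
  contracts A B C (3 / 4).
Proof.
move=> [g0 Cg0] ram d f fd.
(* Only differences of values are bounded, so [a] is taken as the infimum; all values then lie in
   [[a, a + d]]. *)
pose E := f @` binom K C A; pose a := inf E.
have E0 : E !=set0 by exists (f g0), g0.
have lE y : E y -> lbound E (y - d).
  move=> [g Cg <-] _ [h Ch <-]; have := fd _ _ Cg Ch; rewrite ler_norml.
  by move=> /andP[_]; rewrite lerBlDr lerBlDl addrC.
have hl : has_lbound E by exists (f g0 - d); apply: lE; exists g0.
have af g : binom K C A g -> a <= f g by move=> Cg; apply: ge_inf => //; exists g.
have fa g : binom K C A g -> f g <= a + d.
  move=> Cg; rewrite -lerBlDr; apply: lb_le_inf => //; apply: lE; by exists g.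
have d0 : 0 <= d by rewrite (le_trans (normr_ge0 _) (fd _ _ Cg0 Cg0)).
pose up g : R := if a + d / 2 <= f g then 1 else 0.
have /ex_measure1P[m mS mup] : exists2 p, measures K C B p &
    oscillation_le K up p (1 / 2).
  by apply: ram => g _; rewrite /up; case: ifP; [right|left].
exists m => // g1 g2 Bg1 Bg2; have := mup g1 g2 Bg1 Bg2.
have split_f g : m (fun l => f (l \o g)) =
    d / 2 * m (fun l => up (l \o g)) +
    m (fun l => f (l \o g) - d / 2 * up (l \o g)).
  by rewrite (fsmeanB _ _ mS) (fsmeanZ _ _ mS) addrC subrK.
rewrite !split_f => {split_f}.
set u1 := m (fun l => up (l \o g1)); set u2 := m (fun l => up (l \o g2)).
have rest g : binom K B A g ->
    a <= m (fun l => f (l \o g) - d / 2 * up (l \o g)) <= a + d / 2.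
  move=> Bg; rewrite -[X in X <= _ <= _](fsmean_cst a mS).
  rewrite -[X in _ <= _ <= X](fsmean_cst (a + d / 2) mS).
  apply/andP; split; apply: (fsmean_le mS) => l Cl;
    have Clg := binom_comp Cl Bg; have := af _ Clg; have := fa _ Clg;
    rewrite /up; case: ifPn => [|/negP/negP]; rewrite -?ltNge; lra.
move: (rest _ Bg1) (rest _ Bg2).
set v1 := m _; set v2 := m _ => /andP[v1l v1u] /andP[v2l v2u].
rewrite !ler_norml => /andP[ul uu]; apply/andP; split; nra.
Qed.

Lemma binary_to_unit_interval :
  (forall A B, K A -> K B -> leqK K A B ->
     exists C, [/\ K C, leqK K B C & forall f : (A -> C) -> R,
       (forall G, binom K C A G -> f G = 0 \/ f G = 1) ->
       exists2 p, measures K C B p & oscillation_le K f p (1 / 2)]) ->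
  forall A B, K A -> K B -> leqK K A B -> forall e : R, 0 < e ->
     exists C, [/\ K C, leqK K B C & forall f : (A -> C) -> R,
       (forall G, binom K C A G -> 0 <= f G <= 1) ->
       exists2 p, measures K C B p & oscillation_le K f p e].
Proof.
move=> ram A B KA KB AB e e0.
have iter n : exists C, [/\ K C, leqK K B C & contracts A B C ((3 / 4) ^+ n)].
  elim: n => [|n [C [KC BC cC]]].
    by exists B; split=> //; [exists id; exact: binom_id|exact: contracts_refl].
  have AC := leqK_trans AB BC.
  (* [D] is chosen for the pair [A], [C] rather than [A], [B]: averaging over copies of [C] must
     leave a function on [C] of smaller oscillation. *)
  have [D [KD CD rD]] := ram A C KA KC AC.
  exists D; split=> //; first exact: leqK_trans CD.
  rewrite exprSr; apply: contracts_trans cC _.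
  apply: contracts_binary => //; exact: leqK_trans CD.
have [n ne] : exists n, (3 / 4 : R) ^+ n <= e.
  have /cvgrPdist_le/(_ e e0)[n _ /(_ n (leqnn _))] :
      (fun n => (3 / 4 : R) ^+ n) @ \oo --> (0 : R).
    by apply: cvg_expr; rewrite ger0_norm; lra.
  by rewrite /= sub0r normrN normrX ger0_norm; [exists n | lra].
have [C [KC BC cC]] := iter n.
exists C; split=> // f f01; apply/ex_measure1P.
have [g1 g2 Cg1 Cg2|m mS md] := cC 1 f.
  have /andP[? ?] := f01 _ Cg1; have /andP[? ?] := f01 _ Cg2.
  by rewrite ler_norml; lra.
exists m => // g1 g2 Bg1 Bg2; apply: le_trans ne.
by rewrite -[leRHS]mulr1; exact: md.
Qed.

(** Induction on [n] for all [B] at once: [C] handles the first function for [B], and [D] handles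
    the remaining ones with [C] in place of [B]. Averaging over copies of [C] in [D] comes first. *)
Lemma unit_interval_to_finite_families :
  (forall A B, K A -> K B -> leqK K A B -> forall e : R, 0 < e ->
     exists C, [/\ K C, leqK K B C & forall f : (A -> C) -> R,
       (forall G, binom K C A G -> 0 <= f G <= 1) ->
       exists2 p, measures K C B p & oscillation_le K f p e]) ->
  forall A B, K A -> K B -> leqK K A B -> forall e : R, 0 < e ->
  forall n, exists C, [/\ K C, leqK K B C & forall f : 'I_n -> (A -> C) -> R,
       (forall i G, binom K C A G -> 0 <= f i G <= 1) ->
       exists2 p, measures K C B p & forall i, oscillation_le K (f i) p e].
Proof.
move=> ram A B KA KB AB e e0 n; elim: n B KB AB => [|n IH] B KB AB.
  exists B; split=> //; first by exists id; exact: binom_id.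
  move=> f _; apply/ex_measureP; exists (fun phi => phi id); last by case.
  exact/fsmean_dirac/binom_id.
have [C [KC BC rC]] := ram A B KA KB AB e e0.
have [D [KD CD rD]] := IH C KC (leqK_trans AB BC).
exists D; split=> //; first exact: leqK_trans CD.
move=> f f01; apply/ex_measureP.
have /ex_measureP[m1 m1S m1e] :=
  rD (fun i => f (lift ord0 i)) (fun i => f01 (lift ord0 i)).
have F01 g : binom K C A g -> 0 <= m1 (fun l => f ord0 (l \o g)) <= 1.
  move=> Cg; rewrite -[X in X <= _ <= _](fsmean_cst 0 m1S).
  rewrite -[X in _ <= _ <= X](fsmean_cst 1 m1S).
  apply/andP; split; apply: (fsmean_le m1S) => l Dl;
    by have /andP[] := f01 ord0 _ (binom_comp Dl Cg).
have /ex_measure1P[m2 m2S m2e] := rC _ F01.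
exists (fun phi => m2 (fun k => m1 (fun l => phi (l \o k)))).
  by apply: (fsmean_prod m2S m1S) => k l Ck Dl; exact: binom_comp Ck.
move=> i g1 g2 Bg1 Bg2.
case: (unliftP ord0 i) => [j ->|->]; last exact: m2e.
(* The functions already treated satisfy the bound at [k \o g1] and [k \o g2] for each copy [k] of
   [B] in [C], and averaging over [k] keeps it. *)
rewrite -(fsmeanB _ _ m2S); apply: (fsmean_norm_le m2S) => k Ck.
apply: (m1e j (k \o g1) (k \o g2)).
  exact: binom_comp Bg1.
exact: binom_comp Bg2.
Qed.

End finite_equivalences.

(** * Homogeneity of the generic structure *)

Section generic_structure.
Variables (L : language) (K : smooth_class L) (M : structure L).
Hypothesis hM : generic K M.
Implicit Types A B C D : structure L.

Lemma generic_sub (Y : set M) : finite_set Y -> K (substructure Y).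
Proof.
move=> fY; have [_ age _ _] := hM; apply/age; split.
  exact: finite_substructure.
by exists val; exact: embedding_val.
Qed.

(** Each member is [<=] in all later ones. A finite [Y] lies in one of these, and the relation
    restricts to [Y]; hence the members are strong in [M]. *)
Lemma generic_chain : exists A_ : nat -> set M,
  [/\ forall i, strong K (A_ i),
      forall i, K (substructure (A_ i)) &
      forall X, finite_set X -> exists i0, forall i, (i0 <= i)%N -> X `<=` A_ i].
Proof.
have [_ _ [A_ [KA Ach AT]] _] := hM; exists A_.
have Amono i j : (i <= j)%N -> A_ i `<=` A_ j.
  move=> /subnK <-; elim: (j - i)%N => // k IH; rewrite addSn.
  by apply: subset_trans IH (Ach _).1.
have Arle i k : rle K (A_ i) (A_ (k + i)).
  elim: k => [|k IH]; first exact/rle_refl/KA.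
  by apply: (rle_trans (Amono _ _ (leq_addl _ _)) (Ach _).1 IH (Ach _).2).
have absorb X : finite_set X -> exists i0, forall i, (i0 <= i)%N -> X `<=` A_ i.
  move=> fX; have /choice[k kP] : forall x : M, exists k, A_ k x.
    by move=> x; have : [set: M] x by []; rewrite -AT => -[k _ ?]; exists k.
  have /finite_seqP[s sE] := finite_image k fX.
  exists (\max_(n <- s) n)%N => i si x Xx.
  apply: (Amono (k x)); last exact: kP.
  apply: leq_trans si; apply: leq_bigmax_seq => //.
  by have : [set k x | x in X] (k x) by [exists x]; rewrite sE.
have finA i : finite_set (A_ i).
  rewrite -[A_ i](@range_val L M); apply: finite_image.
  exact: sc_finite (KA i).
split=> // i; split=> // Y fY AY; have [i0 i0P] := absorb Y fY.
apply: (rle_sub AY (i0P (i0 + i)%N (leq_addr _ _)) (Arle i i0)).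
Qed.

Lemma strong_cofinal (X : set M) : finite_set X ->
  exists2 Y, strong K Y & X `<=` Y.
Proof.
have [A_ [sA _ absorb]] := generic_chain => /absorb[i0 i0P].
by exists (A_ i0) => //; exact: i0P.
Qed.

Lemma binom_val (X : set M) : strong K X -> binom K M (substructure X) val.
Proof. by move=> sX; split; [exact: embedding_val | rewrite range_val]. Qed.

(** Richness of [M], freed from the requirement that the smaller structure be a subset of [M]. *)
Lemma generic_extension D D' (l : D -> M) (j : D -> D') :
  K D' -> binom K M D l -> binom K D' D j ->
  exists2 l', binom K M D' l' & l' \o j = l.
Proof.
move=> KD' bl bj; have [_ _ _ richM] := hM; have [el sl] := bl.
have [h hi lh] : exists2 h : substructure (range l) -> D,
    isomorphism h & l \o h = val.
  by apply: factor_same_range; rewrite ?range_val//; exact: embedding_val.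
have bh : binom K D (substructure (range l)) h.
  by apply: (binom_factor el); rewrite lh; exact: binom_val.
have [l' bl' l'jh] := richM _ _ _ sl KD' (binom_comp bj bh).
exists l' => //; case: hi => -[k hK kK] _; apply/funext => d /=.
have := congr1 (fun q => q (k d)) l'jh; rewrite /= kK => ->.
by rewrite -lh /= kK.
Qed.

(** Richness over the empty set. Positive arities make the empty map an embedding: no tuple has its
    entries there. *)
Lemma generic_universal B : K B -> binom K M B !=set0.
Proof.
move=> KB; have [_ _ _ richM] := hM.
have s0 : strong K (@set0 M).
  split=> // Y fY _; rewrite preimage_set0.
  exact/sc_le_empty/generic_sub.
have no_elt (x : substructure (@set0 M)) : False by exact: (set_mem (valP x)).
pose g (x : substructure (@set0 M)) : B := match no_elt x with end.
have [|G bG _] := richM _ _ g s0 KB; last by exists G.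
split; last first.
  apply/strongE => //; rewrite (_ : range g = set0); first exact: sc_le_empty.
  by apply/seteqP; split=> // y [x]; case: (no_elt x).
split=> [x|s t]; first by case: (no_elt x).
by case: (no_elt (tnth t (Ordinal (arity_gt0 s)))).
Qed.

(** Finite partial automorphisms between strong subsets are kept as graphs: extending is then
    inclusion, and inverting is transposition. *)
Definition partial_auto (P : set (M * M)) :=
  exists D (l1 l2 : D -> M), [/\ binom K M D l1, binom K M D l2 &
    P = range (fun d => (l1 d, l2 d))].

Definition transpose (P : set (M * M)) : set (M * M) := [set x | P (x.2, x.1)].

Lemma partial_auto_transpose P : partial_auto P -> partial_auto (transpose P).
Proof.
move=> [D [l1 [l2 [b1 b2 ->]]]]; exists D, l2, l1; split=> //.
by apply/seteqP; split=> [[x y] [d _ [<- <-]]|_ [d _ <-]]; exists d.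
Qed.

(** A strong finite [Y] containing the domain and [a] is an extension of [D]; [generic_extension]
    prolongs [l2] to it. *)
Lemma partial_auto_forth P a : partial_auto P ->
  exists P', [/\ partial_auto P', P `<=` P' & exists b, P' (a, b)].
Proof.
move=> [D [l1 [l2 [b1 b2 ->]]]]; have [e1 [f1 _]] := b1.
have [|Y sY l1aY] := @strong_cofinal (range l1 `|` [set a]).
  by rewrite finite_setU.
have [|j jE] := @corestrict _ D M Y l1; first by apply: subset_trans l1aY; left.
have bj : binom K (substructure Y) D j.
  by apply: (binom_factor (@embedding_val _ _ Y)); rewrite jE.
have [l' bl' l'j] := generic_extension (generic_sub sY.1) b2 bj.
exists (range (fun d => (val d, l' d))); split.
- by exists (substructure Y), val, l'; split=> //; exact: binom_val.
- move=> _ [d _ <-]; exists (j d) => //.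
  by rewrite -[l2 d](congr1 (fun q => q d) l'j) -[l1 d](congr1 (fun q => q d) jE).
- have Ya : Y a by apply: l1aY; right.
  by exists (l' (SigSub (mem_set Ya))); exists (SigSub (mem_set Ya)).
Qed.

Lemma partial_auto_back P b : partial_auto P ->
  exists P', [/\ partial_auto P', P `<=` P' & exists a, P' (a, b)].
Proof.
move=> /partial_auto_transpose/(partial_auto_forth b)[P' [pP' PP' [a P'a]]].
exists (transpose P'); split; [exact: partial_auto_transpose| |by exists a].
by move=> [x y] Pxy; exact: PP'.
Qed.

Lemma partial_auto_inj P x y x' y' : partial_auto P ->
  P (x, y) -> P (x', y') -> x = x' <-> y = y'.
Proof.
move=> [D [l1 [l2 [[[i1 _] _] [[i2 _] _] ->]]]] [d _ [<- <-]] [d' _ [<- <-]].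
by split=> [/i1 ->|/i2 ->].
Qed.

Lemma partial_auto_interp P (g : M -> M) (s : L) (t : (arity s).-tuple M) :
  partial_auto P -> (forall x, x \in (t : seq M) -> P (x, g x)) ->
  interp t <-> interp (map_tuple g t).
Proof.
move=> [D [l1 [l2 [[[i1 r1] _] [[i2 r2] _] ->]]]] tP.
have /choice[h hE] : forall x, exists d,
    x \in (t : seq M) -> l1 d = x /\ l2 d = g x.
  move=> x; have [/tP[d _ [<- <-]]|xt] := boolP (x \in (t : seq M)).
    by exists d.
  (* Outside [t] the value of [h] is irrelevant, but [D] must have an element; the first entry of
     [t], present because arities are positive, supplies one. *)
  have [d _ _] : range (fun d => (l1 d, l2 d)) (tnth t (Ordinal (arity_gt0 s)),
      g (tnth t (Ordinal (arity_gt0 s)))) by apply: tP; exact: mem_tnth.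
  by exists d.
have -> : t = map_tuple l1 (map_tuple h t).
  apply: val_inj; rewrite /= -map_comp -[LHS]map_id.
  by apply/eq_in_map => x /hE[].
have -> : map_tuple g (map_tuple l1 (map_tuple h t)) =
    map_tuple l2 (map_tuple h t).
  apply: val_inj; rewrite /= -!map_comp.
  by apply/eq_in_map => x /hE[/= -> ->].
by rewrite -r1 r2.
Qed.

Lemma homogeneous D (l1 l2 : D -> M) :
  binom K M D l1 -> binom K M D l2 -> exists g : Aut M, g \o l1 = l2.
Proof.
move=> b1 b2; have [/countable_injP[c cI] _ _ _] := hM.
(* Stage [n] puts the element of code [n] under [c], if there is one, into both the domain and the
   range. *)
have step (x : nat * set (M * M)) : exists P', partial_auto x.2 ->
    [/\ partial_auto P', x.2 `<=` P' & forall a, c a = x.1 ->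
       (exists b, P' (a, b)) /\ (exists b, P' (b, a))].
  have [[a ca]|na] := pselect (exists a, c a = x.1); last first.
    by exists x.2 => pP; split=> // a ca; case: na; exists a.
  have [pP|npP] := pselect (partial_auto x.2); last by exists x.2.
  have [P1 [pP1 P01 [b P1b]]] := partial_auto_forth a pP.
  have [P2 [pP2 P12 [b' P2b]]] := partial_auto_back a pP1.
  exists P2 => _; split=> // [|a' ca']; first exact: subset_trans P12.
  rewrite (_ : a' = a); last by apply: cI; rewrite ?ca'//; exact: mem_set.
  by split; [exists b; exact: P12 | exists b'].
have [F FP] := choice step => {step}.
pose P_ := fix P_ n := if n is k.+1 then F (k, P_ k) else
  range (fun d => (l1 d, l2 d)).
have pP n : partial_auto (P_ n).
  elim: n => [|n IH]; first by exists D, l1, l2.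
  by have [] := FP (n, P_ n) IH.
have Pmono m n : (m <= n)%N -> P_ m `<=` P_ n.
  move=> /subnK <-; elim: (n - m)%N => // k IH; rewrite addSn.
  apply: subset_trans IH _.
  by have [] := FP (k + m, P_ (k + m))%N (pP _).
have Pinj m n x y x' y' : P_ m (x, y) -> P_ n (x', y') -> x = x' <-> y = y'.
  move=> /(Pmono _ _ (leq_maxl m n)) Pm /(Pmono _ _ (leq_maxr m n)) Pn.
  exact: (partial_auto_inj (pP (maxn m n))).
have /choice[g gP] : forall a, exists b, exists n, P_ n (a, b).
  move=> a; have [_ _ /(_ a erefl)[[b Pab] _]] := FP (c a, P_ (c a)) (pP _).
  by exists b, (c a).+1.
have /choice[h hP] : forall a, exists b, exists n, P_ n (b, a).
  move=> a; have [_ _ /(_ a erefl)[_ [b Pba]]] := FP (c a, P_ (c a)) (pP _).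
  by exists b, (c a).+1.
have gK : cancel g h.
  move=> x; have [m Pm] := gP x; have [n Pn] := hP (g x).
  exact/esym/(Pinj _ _ _ _ _ _ Pm Pn).
have hK : cancel h g.
  move=> x; have [m Pm] := hP x; have [n Pn] := gP (h x).
  exact/esym/(Pinj _ _ _ _ _ _ Pm Pn).
have gi : isomorphism g.
  split; first by exists h.
  split=> [|s t]; first exact: can_inj gK.
  have /choice[k kP] := gP.
  (* All entries of [t] enter the domain by one large stage, so a single partial automorphism
     decides the relation. *)
  apply: (@partial_auto_interp (P_ (\max_(x <- t) k x)%N)) => // x xt.
  by apply: (Pmono (k x)) => //; apply: leq_bigmax_seq.
exists (Automorphism gi); apply/funext => d /=.
have [n Pn] := gP (l1 d); have P0 : P_ 0 (l1 d, l2 d) by exists d.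
exact/(Pinj _ _ _ _ _ _ Pn P0).
Qed.

End generic_structure.

(** * Compactness: from the generic structure to finite structures *)

Lemma filter_finite_forall (T I : Type) (F : set_system T) (E : set I)
    (P : I -> set T) : Filter F -> finite_set E ->
  (forall x, E x -> F (P x)) -> F [set t | forall x, E x -> P x t].
Proof.
elim/Pchoice: I => I in E P *; move=> FF fE FP.
have := @filter_bigI _ _ (fset_set E) P F FF; set S := (X in F X).
have -> : S = [set t | forall x, E x -> P x t].
  apply/seteqP; split=> t Pt x.
    by move=> Ex; apply: Pt; rewrite /= in_fset_set// mem_set.
  by rewrite /= in_fset_set// => /set_mem; exact: Pt.
by apply=> x; rewrite in_fset_set// => /set_mem; exact: FP.
Qed.

Section compactness.
Variables (R : realType) (L : language) (K : smooth_class L) (M : structure L).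
Hypothesis hM : generic K M.

(* Compactness: bad colourings of the members of the chain exhausting [M] have
   a limit along an ultrafilter, which is a bad colouring of [M]. *)
Lemma convex_Ramsey_finite : convex_Ramsey K R M ->
  forall A B, K A -> K B -> leqK K A B ->
  exists C, [/\ K C, leqK K B C & forall f : (A -> C) -> R,
    (forall G, binom K C A G -> f G = 0 \/ f G = 1) ->
    exists2 p, measures K C B p & oscillation_le K f p (1 / 2)].
Proof.
move=> ram A B KA KB AB; apply: contrapT => noC.
have [A_ [sA KA_ absorb]] := generic_chain hM.
have [b0 bb0] := generic_universal hM KB.
have [i0 i0P] := absorb (range b0) bb0.2.1.
(* [F i] is a bad colouring of [A_ i] carried to [M], with default 0. Before stage [i0] the copy
   [b0] of [B] may not fit, and badness is not claimed. *)
have /choice[F FP] : forall i, exists F : (A -> M) -> R,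
    (forall H, F H = 0 \/ F H = 1) /\ ((i0 <= i)%N ->
    forall m, fsmeans (binom K (substructure (A_ i)) B) m ->
    ~ osc_le K (fun g : A -> substructure (A_ i) => F (val \o g)) m (1 / 2)).
  move=> i; have [i0i|i0i] := leqP i0 i; last by exists (fun=> 0); split=> //; left.
  have BAi : leqK K B (substructure (A_ i)).
    have [b bE] := corestrict (i0P i i0i); exists b.
    by apply: (binom_factor (@embedding_val _ _ (A_ i))); rewrite bE.
  have /existsNP[f /not_implyP[f01 nof]] :
      ~ forall f : (A -> substructure (A_ i)) -> R,
      (forall G, binom K (substructure (A_ i)) A G -> f G = 0 \/ f G = 1) ->
      exists2 p, measures K (substructure (A_ i)) B p &
        oscillation_le K f p (1 / 2).
    by move=> allf; apply: noC; exists (substructure (A_ i)).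
  pose F H : R :=
    if pselect (exists g, val \o g = H /\ f g = 1) then 1 else 0.
  exists F; split; first by move=> H; rewrite /F; case: pselect; [right|left].
  move=> _ m mS oscF; apply/nof/ex_measure1P; exists m => // g1 g2 Bg1 Bg2.
  have Ff g : binom K B A g ->
      m (fun l => f (l \o g)) = m (fun l => F (val \o (l \o g))).
    move=> Bg; apply: (fsmean_eq mS) => l bl.
    have := f01 _ (binom_comp bl Bg); rewrite /F.
    case: pselect => [[h [hE fh]] _|nh []//]; last first.
      by move=> f1; case: nh; exists (l \o g).
    rewrite /= -[RHS]fh; congr f; apply/funext => a; apply: val_inj.
    exact: (congr1 (fun q => q a) (esym hE)).
  by rewrite !Ff//; exact: oscF.
have [U [UU ooU]] := ultraFilterLemma eventually_filter.
pose f H : R := if pselect (U [set i | F i H = 1]) then 1 else 0.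
have fF H : U [set i | F i H = f H].
  rewrite /f; case: pselect => // nU.
  have [//|UC] := in_ultra_setVsetC [set i | F i H = 1] UU.
  by apply: filterS UC => i /=; case: ((FP i).1 H).
have f01 H : binom K M A H -> f H = 0 \/ f H = 1.
  by move=> _; rewrite /f; case: pselect; [right|left].
have /ex_measure1P[m mS osc] := ram A B KA KB AB f f01.
case: (mS) => J [w [l_ [w0 w1 Sl mE]]].
have UP : U [set i | (i0 <= i)%N].
  by apply: ooU; exists i0.
have Ul : U [set i | forall k, [set: J] k -> range (l_ k) `<=` A_ i].
  apply: filter_finite_forall => [|k _]; first exact: finite_finset.
  have [j jP] := absorb _ (Sl k).2.1.
  by apply: ooU; exists j.
have UF : U [set i | forall k, [set: J] k -> forall g, binom K B A g ->
    F i (l_ k \o g) = f (l_ k \o g)].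
  apply: (@filter_finite_forall _ _ U [set: J]
    (fun k => [set i | forall g, binom K B A g ->
      F i (l_ k \o g) = f (l_ k \o g)])) => [|k _]; first exact: finite_finset.
  apply: (@filter_finite_forall _ _ U (binom K B A)
    (fun g => [set i | F i (l_ k \o g) = f (l_ k \o g)])) => [|g _].
    exact: finite_binom.
  exact: fF.
(* Only finitely many copies [l_ k] of [B] and finitely many [g] matter. One stage [i] contains
   these copies and has [F i] equal to [f] on their subcopies of [A]; there [m] refutes the badness
   of [F i]. *)
have [i [[i0i li] Fi]] := filter_ex (filterI (filterI UP Ul) UF).
have /choice[l' l'E] : forall k, exists l' : B -> substructure (A_ i),
    val \o l' = l_ k.
  by move=> k; exact: corestrict (li k I).
pose m' (phi : (B -> substructure (A_ i)) -> R) := \sum_k w k * phi (l' k).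
apply: ((FP i).2 i0i m') => [|g1 g2 Bg1 Bg2].
  exists J, w, l'; split=> // k.
  by apply: (binom_factor (@embedding_val _ _ (A_ i))); rewrite l'E.
have m'm g : binom K B A g ->
    m' (fun l => F i (val \o (l \o g))) = m (fun l => f (l \o g)).
  move=> Bg; rewrite mE; apply: eq_bigr => k _.
  by rewrite -Fi// -l'E.
by rewrite !m'm//; exact: osc.
Qed.

End compactness.

(** * Invariant measures *)

Section regularization.
Variables (R : realType) (X : ptopologicalType).
Hypotheses (cX : compact [set: X]) (hX : hausdorff_space X).
Variable lam : set X -> R.
Hypothesis lam0 : lam set0 = 0.
Hypothesis lamT : lam setT = 1.
Hypothesis lam_mono : forall A B, A `<=` B -> lam A <= lam B.
Hypothesis lam_add : forall A B, A `&` B = set0 -> lam (A `|` B) = lam A + lam B.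

Local Open Scope ereal_scope.

(** Meant for open sets: on them it is the content from which a regular measure is built, [lam]
    being only finitely additive. *)
Definition inner (U : set X) : \bar R :=
  ereal_sup [set (lam C)%:E | C in [set C | closed C /\ C `<=` U]].

Definition outer (E : set X) : \bar R :=
  ereal_inf [set inner U | U in [set U | open U /\ E `<=` U]].

Let normalX : normal_space X. Proof. exact: compact_normal. Qed.

Lemma lam_le_inner C U : closed C -> C `<=` U -> (lam C)%:E <= inner U.
Proof. by move=> cC CU; apply: ereal_sup_ubound; exists C. Qed.

Lemma inner_ge0 U : 0 <= inner U.
Proof.
by rewrite -[0]/(0%R%:E) -lam0; apply: lam_le_inner => //; exact: closed0.
Qed.

Lemma inner_le1 U : inner U <= 1.
Proof.
apply: ge_ereal_sup => _ [C _ <-]; rewrite lee_fin -lamT; exact: lam_mono.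
Qed.

Lemma inner_fin U : inner U \is a fin_num.
Proof.
by rewrite ge0_fin_numE ?inner_ge0// (le_lt_trans (inner_le1 U))// ltry.
Qed.

Lemma inner_mono U V : U `<=` V -> inner U <= inner V.
Proof.
move=> UV; apply: ge_ereal_sup => _ [C [cC CU] <-].
by apply: lam_le_inner => //; exact: subset_trans UV.
Qed.

Lemma outer_ge0 E : 0 <= outer E.
Proof. by apply: le_ereal_inf_tmp => _ [U _ <-]; exact: inner_ge0. Qed.

Lemma outer_le_inner E U : open U -> E `<=` U -> outer E <= inner U.
Proof. by move=> oU EU; apply: ereal_inf_lbound; exists U. Qed.

Lemma outer_open U : open U -> outer U = inner U.
Proof.
move=> oU; apply/eqP; rewrite eq_le outer_le_inner//=.
by apply: le_ereal_inf_tmp => _ [V [oV UV] <-]; exact: inner_mono.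
Qed.

Lemma outer_fin E : outer E \is a fin_num.
Proof.
rewrite ge0_fin_numE ?outer_ge0//; apply: le_lt_trans (ltry 1).
exact: le_trans (outer_le_inner openT (@subsetT _ E)) (inner_le1 _).
Qed.

Lemma outer_mono : {homo outer : A B / A `<=` B >-> A <= B}.
Proof.
move=> A B AB; apply: le_ereal_inf_tmp => _ [U [oU BU] <-].
by apply: outer_le_inner => //; exact: subset_trans BU.
Qed.

Lemma outer0 : outer set0 = 0.
Proof.
rewrite outer_open; last exact: open0.
apply/eqP; rewrite eq_le inner_ge0 andbT; apply: ge_ereal_sup => _ [C [_ C0] <-].
by rewrite lee_fin -lam0; exact: lam_mono.
Qed.

Lemma outerT : outer setT = 1.
Proof.
rewrite outer_open; last exact: openT.
apply/eqP; rewrite eq_le inner_le1/= -lamT.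
by apply: lam_le_inner; first exact: closedT.
Qed.

(** For closed [C] in the union, [C] minus [U] and [C] minus [V] are disjoint and closed. Normality
    separates them by [W1] and [W2], and removing these from [C] leaves two closed sets, one in [U],
    one in [V], that cover [C]. *)
Lemma inner_setU U V : open U -> open V -> inner (U `|` V) <= inner U + inner V.
Proof.
move=> oU oV; apply: ge_ereal_sup => _ [C [cC CUV] <-].
have cl W : open W -> closed (C `\` W).
  by move=> oW; rewrite setDE; apply: closedI => //; exact: open_closedC.
have CUV0 : (C `\` U) `&` (C `\` V) = set0.
  by apply/seteqP; split=> // x [[Cx nU] [_ nV]]; case: (CUV _ Cx).
have /(@normal_openP R) sep := normalX.
have [W1 [W2 [oW1 oW2 CU CV W12]]] := sep _ _ (cl _ oU) (cl _ oV) CUV0.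
have C1 : C `\` W1 `<=` U.
  by move=> x [Cx nx]; apply: contrapT => nU; apply/nx/CU.
have C2 : C `\` W2 `<=` V.
  by move=> x [Cx nx]; apply: contrapT => nV; apply/nx/CV.
apply: (@le_trans _ _ ((lam (C `\` W1))%:E + (lam (C `\` W2))%:E)); last first.
  by apply: leeD; apply: lam_le_inner => //; exact: cl.
rewrite -EFinD lee_fin.
rewrite (@le_trans _ _ (lam ((C `\` W1) `|` (C `&` W1))))//.
  by apply: lam_mono => x Cx; have [|] := pselect (W1 x); [right|left].
rewrite lam_add; last by apply/seteqP; split=> // x [[_ ?] [_ ?]].
rewrite lerD2l; apply: lam_mono => x [Cx W1x]; split=> // W2x.
by have : (W1 `&` W2) x by []; rewrite W12.
Qed.

(** A closed subset of the union is compact, hence covered by finitely many [U i]; finite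
    subadditivity then suffices. *)
Lemma inner_bigcup (U : (set X)^nat) : (forall n, open (U n)) ->
  inner (\bigcup_n U n) <= \sum_(i <oo) inner (U i).
Proof.
move=> oU; apply: ge_ereal_sup => _ [C [cC CU] <-].
have cC' : compact C by apply: subclosed_compact cX _.
move: cC'; rewrite compact_cover => /(_ nat setT U (fun i _ => oU i) CU).
move=> [D _ CD].
pose N := (\max_(i <- D) i).+1.
have CN : C `<=` \big[setU/set0]_(i < N) U i.
  move=> x /CD[i /= iD Uix]; rewrite -bigcup_mkord; exists i => //=.
  by rewrite /N ltnS; apply: leq_bigmax_seq.
apply: (@le_trans _ _ (inner (\big[setU/set0]_(i < N) U i))).
  exact: lam_le_inner.
apply: (@le_trans _ _ (\sum_(i < N) inner (U i))); last first.
  rewrite -(big_mkord xpredT (fun i => inner (U i))).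
  by apply: nneseries_lim_ge => *; exact: inner_ge0.
elim: N {CN} => [|n IH].
  rewrite !big_ord0 -outer_open ?outer0//; exact: open0.
rewrite !big_ord_recr/=; apply: le_trans (inner_setU _ _) _ => //.
  by rewrite -bigcup_mkord; apply: bigcup_open => i _; exact: oU.
exact: leeD.
Qed.

Lemma outer_sigma_subadditive : sigma_subadditive outer.
Proof.
move=> A; apply/lee_addgt0Pr => e e0.
rewrite (le_trans _ (epsilon_trick _ _ (ltW e0)))//; last first.
  by move=> n; exact: outer_ge0.
have /choice[U UP] : forall n, exists U, [/\ open U, A n `<=` U &
    inner U <= outer (A n) + (e / (2 ^ n.+1)%:R)%:E].
  move=> n; have en : (0 < e / (2 ^ n.+1)%:R)%R.
    by rewrite divr_gt0// ltr0n expn_gt0.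
  have [_ [U [oU AU] <-] Ue] := lb_ereal_inf_adherent en (outer_fin (A n)).
  by exists U; split=> //; exact: ltW.
apply: (@le_trans _ _ (inner (\bigcup_n U n))).
  apply: outer_le_inner; first by apply: bigcup_open => n _; have [] := UP n.
  by apply: subset_bigcup => n _; have [] := UP n.
apply: (le_trans (inner_bigcup _)); first by move=> n; have [] := UP n.
apply: lee_nneseries => [n _ _|n _]; first exact: inner_ge0.
by have [] := UP n.
Qed.

(** Inside an open [U] containing [E], closed sets [C] and [C'] nearly exhaust [U] in [V] and then
    [U] off [C]. They are disjoint, so their values add up to at most [inner U]. This is the
    criterion of Caratheodory for open sets. *)
Lemma outer_open_split V E : open V ->
  outer (E `&` V) + outer (E `&` ~` V) <= outer E.
Proof.
move=> oV; apply: le_ereal_inf_tmp => _ [U [oU EU] <-].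
apply: (@le_trans _ _ (outer (U `&` V) + outer (U `&` ~` V))).
  by apply: leeD; apply: outer_mono; exact: setSI.
apply/lee_addgt0Pr => e e0; have e2 : (0 < e / 2)%R by rewrite divr_gt0.
have oUV : open (U `&` V) by exact: openI.
rewrite (outer_open oUV).
have [_ [C [cC CUV] <-] Ce] := ub_ereal_sup_adherent e2 (inner_fin (U `&` V)).
have oUC : open (U `&` ~` C) by apply: openI => //; exact: closed_openC.
have [_ [C' [cC' CUC] <-] C'e] := ub_ereal_sup_adherent e2 (inner_fin (U `&` ~` C)).
apply: (@le_trans _ _ (inner (U `&` V) + inner (U `&` ~` C))).
  rewrite leeD2l//; apply: outer_le_inner => //.
  by move=> x [Ux nV]; split=> // /CUV[].
have : (lam C)%:E + (lam C')%:E <= inner U.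
  rewrite -EFinD -lam_add; last first.
    by apply/seteqP; split=> // x [Cx /CUC[]].
  apply: lam_le_inner; first exact: closedU.
  by move=> x [/CUV[]|/CUC[]].
move: Ce C'e; rewrite -/(inner _) -/(inner _).
rewrite -(fineK (inner_fin (U `&` V))) -(fineK (inner_fin (U `&` ~` C))).
rewrite -(fineK (inner_fin U)) -!EFinB -!EFinD !lte_fin !lee_fin; lra.
Qed.

Lemma regular_probability :
  exists mu : probability (g_sigma_algebraType (@open X)) R,
    forall E, mu E = outer E.
Proof.
pose om : {outer_measure set X -> \bar R} :=
  HB.pack outer (isOuterMeasure.Build R X outer outer0 outer_ge0 outer_mono
    outer_sigma_subadditive).
have borel_cara : <<s @open X >> `<=` caratheodory_measurable om.
  apply: smallest_sub.
    split; first exact: caratheodory_measurable_set0.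
      by move=> A mA; rewrite setTD; exact: caratheodory_measurable_setC.
    by move=> A mA; exact: caratheodory_measurable_bigcup.
  by move=> V oV; apply: le_caratheodory_measurable => E; exact: outer_open_split.
have sadd : semi_sigma_additive (outer : set (g_sigma_algebraType (@open X)) -> _).
  move=> F mF tF mUF.
  apply: (@caratheodory_measure_sigma_additive R X om) => //.
    by move=> i; exact: borel_cara (mF i).
  exact: borel_cara.
pose m1 := isMeasure.Build _ (g_sigma_algebraType (@open X)) R
  (outer : set (g_sigma_algebraType (@open X)) -> \bar R) outer0 outer_ge0 sadd.
pose mu : {measure set (g_sigma_algebraType (@open X)) -> \bar R} := HB.pack
  (outer : set (g_sigma_algebraType (@open X)) -> \bar R) m1.
pose m2 := Measure_isProbability.Build _ _ _ mu outerT.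
pose P : probability (g_sigma_algebraType (@open X)) R :=
  HB.pack (outer : set (g_sigma_algebraType (@open X)) -> \bar R) m1 m2.
by exists P.
Qed.

End regularization.

Lemma ultra_fmap (T U : Type) (h : T -> U) (F : set_system T) :
  UltraFilter F -> UltraFilter (h @ F).
Proof.
move=> UF; split; first exact: fmap_proper_filter.
move=> G GG FG; apply/seteqP; split=> // A GA.
have [//|FnA] := in_ultra_setVsetC (h @^-1` A) UF.
have /FG GnA : (h @ F) (~` A) by [].
have G0 : G (A `&` ~` A) by exact: filterI.
by move: G0; rewrite setICr => /(filter_not_empty G).
Qed.

Lemma ultra_cvg01 (R : realType) (T : Type) (h : T -> R) (F : set_system T) :
  UltraFilter F -> F [set t | 0 <= h t <= 1] -> cvg (h @ F).
Proof.
move=> UF Fh; have UhF := ultra_fmap h UF.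
have := @segment_compact R 0 1; rewrite compact_ultra.
move=> /(_ (h @ F) UhF)[|p [_ hp]]; last by apply/cvg_ex; exists p.
by apply: (@filterS _ F _ _ _ _ Fh) => t ht; rewrite /= in_itv.
Qed.

Lemma ler_filter_cvg (R : realType) (T : Type) (F : set_system T)
    (f g : T -> R) (l l' : R) : ProperFilter F ->
  f @ F --> l -> g @ F --> l' -> F [set t | f t <= g t] -> l <= l'.
Proof.
move=> FF fl gl fg; rewrite leNgt; apply/negP => l'l.
have e0 : 0 < (l - l') / 2 by rewrite divr_gt0 ?subr_gt0.
have /cvgrPdist_lt/(_ _ e0) fe := fl; have /cvgrPdist_lt/(_ _ e0) ge := gl.
have [t [/= fgt [ft gt]]] := filter_ex (filterI fg (filterI fe ge)).
by move: ft gt; rewrite !ltr_norml; lra.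
Qed.

(** * From almost invariant means to an invariant probability *)

Section invariant_measure.
Variables (R : realType) (G : topologicalGroupType) (X : ptopologicalType).
Variable a : G -> X -> X.
Hypotheses (cX : compact [set: X]) (hX : hausdorff_space X).
Hypothesis aX : continuous_action a.

Definition unit_valued (f : X -> R) := forall x, 0 <= f x <= 1.

Hypothesis almost_invariant : forall (s : seq (G * (X -> R))) (e : R), 0 < e ->
  (forall x, x \in s -> continuous x.2 /\ unit_valued x.2) ->
  exists2 m, fsmeans [set: X] m &
    forall x, x \in s -> `|m (x.2 \o a x.1) - m x.2| <= e.

Lemma action_continuous g : continuous (a g).
Proof.
have [_ _ ca] := aX; move=> x.
apply: (@continuous_comp _ _ _ (fun y => (g, y)) (fun y => a y.1 y.2)).
  by apply: cvg_pair; [exact: cvg_cst|exact: cvg_id].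
exact: ca.
Qed.

Lemma actionVK g : cancel (a g^-1%g) (a g).
Proof. by have [a1 aM _] := aX; move=> x; rewrite -aM mulgV a1. Qed.

(** Almost invariant means form a filter base: two conditions are met jointly by concatenating lists
    and taking the smaller tolerance. [Lm] is the limit along a finer ultrafilter; it exists by
    compactness for functions valued in the unit interval. *)
Lemma invariant_mean : exists Lm : (X -> R) -> R,
  [/\ forall c, 0 <= c <= 1 -> Lm (fun=> c) = c,
      forall f g, unit_valued f -> unit_valued g -> (forall x, f x <= g x) ->
        Lm f <= Lm g,
      forall f g, unit_valued f -> unit_valued g ->
        unit_valued (fun x => f x + g x) ->
        Lm (fun x => f x + g x) = Lm f + Lm g &
      forall g f, continuous f -> unit_valued f -> Lm (f \o a g) = Lm f].
Proof.
pose D := [set i : seq (G * (X -> R)) * R | 0 < i.2 /\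
  forall x, x \in i.1 -> continuous x.2 /\ unit_valued x.2].
pose B (i : seq (G * (X -> R)) * R) := [set m | fsmeans [set: X] m /\
  forall x, x \in i.1 -> `|m (x.2 \o a x.1) - m x.2| <= i.2].
have FF : ProperFilter (filter_from D B).
  apply: filter_from_proper.
    apply: filter_from_filter; first by exists ([::], 1); split.
    move=> [s e] [s' e'] [e0 sP] [e'0 s'P].
    exists (s ++ s', Num.min e e').
      split=> /=; first by rewrite lt_min e0 e'0.
      by move=> x; rewrite mem_cat => /orP[/sP|/s'P].
    move=> m [mS mP] /=; split; split=> // x xs.
      apply: le_trans (mP x _) _; first by rewrite mem_cat xs.
      by rewrite ge_min lexx.
    apply: le_trans (mP x _) _; first by rewrite mem_cat xs orbT.
    by rewrite ge_min lexx orbT.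
  move=> [s e] [e0 sP]; have [m mS mP] := almost_invariant e0 sP.
  by exists m.
have [U [UU FU]] := ultraFilterLemma FF.
have Umean : U [set m | fsmeans [set: X] m].
  by apply: FU; exists ([::], 1); [split|move=> m []].
pose Lm f := lim ((fun m => m f) @ U).
have Lcvg f : unit_valued f -> m f @[m --> U] --> Lm f.
  move=> f01; apply: (@ultra_cvg01 R _ (fun m => m f)).
  apply: filterS Umean => m mS /=.
  rewrite -[X in X <= _ <= _](fsmean_cst 0 mS).
  rewrite -[X in _ <= _ <= X](fsmean_cst 1 mS).
  by apply/andP; split; apply: (fsmean_le mS) => x _; case/andP: (f01 x).
exists Lm; split.
- move=> c c01; apply: (@cvg_unique _ _ (m (fun=> c) @[m --> U])) => //.
    exact: Lcvg.
  apply: cvg_near_cst; apply: (@filterS _ U _ _ _ _ Umean) => m mS.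
  exact: (fsmean_cst c mS).
- move=> f g f01 g01 fg.
  apply: (@ler_filter_cvg R _ U (fun m => m f) (fun m => m g)).
  1,2: exact: Lcvg.
  by apply: (@filterS _ U _ _ _ _ Umean) => m mS; apply: (fsmean_le mS).
- move=> f g f01 g01 fg01.
  apply: (@cvg_unique _ _ (m (fun x => f x + g x) @[m --> U])) => //.
    exact: Lcvg.
  apply: cvg_trans (cvgD (Lcvg f f01) (Lcvg g g01)).
  apply: near_eq_cvg; apply: (@filterS _ U _ _ _ _ Umean) => m mS.
  by rewrite /= (fsmeanD _ _ mS).
- move=> g f cf f01.
  have fg01 : unit_valued (f \o a g) by move=> x; exact: f01.
  apply/eqP; rewrite -subr_eq0 -normr_le0; apply/ler_addgt0Pr => e e0.
  rewrite add0r.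
  apply: (@ler_filter_cvg R _ U (fun m => `|m (f \o a g) - m f|) (fun=> e)).
  - by apply: cvg_norm; apply: cvgB; exact: Lcvg.
  - exact: cvg_cst.
  have : U (B ([:: (g, f)], e)).
    apply: FU; exists ([:: (g, f)], e) => //.
    by split=> // x; rewrite inE => /eqP ->.
  by apply: (@filterS _ U) => m [_ /(_ (g, f))]; rewrite inE eqxx; exact.
Qed.

(** [Lm] is known to be invariant on continuous functions only, not on indicators. A Urysohn
    function is therefore inserted between a closed set and an open one before translating, which
    compares the inner values of open sets. *)
Lemma invariant_probability :
  exists mu : probability (g_sigma_algebraType (@open X)) R,
    forall g (U : set (g_sigma_algebraType (@open X))),
      measurable U -> mu (a g @^-1` U) = mu U.
Proof.
have [Lm [Lcst Lmono Ladd Linv]] := invariant_mean.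
have ind01 (S : set X) : unit_valued (\1_S : X -> R).
  by move=> x; rewrite indicE; case: (x \in S); rewrite ?lexx ?ler01.
pose lam (S : set X) : R := Lm \1_S.
have lam0 : lam set0 = 0.
  rewrite /lam indic0; apply: Lcst; by rewrite lexx ler01.
have lamT : lam setT = 1.
  rewrite /lam indicT; apply: Lcst; by rewrite lexx ler01.
have lam_mono A B : A `<=` B -> lam A <= lam B.
  move=> AB; apply: Lmono => // x; rewrite !indicE ler_nat.
  by case: (boolP (x \in A)) => // /set_mem/AB/mem_set ->.
have lam_add A B : A `&` B = set0 -> lam (A `|` B) = lam A + lam B.
  move=> AB0; have E : \1_(A `|` B) = (fun x => \1_A x + \1_B x) :> (X -> R).
    apply/funext => x; rewrite !indicE in_setU -natrD; congr (_%:R).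
    case: (boolP (x \in A)) => //= /set_mem Ax.
    case: (boolP (x \in B)) => //= /set_mem Bx.
    by have : (A `&` B) x by []; rewrite AB0.
  by rewrite /lam E Ladd// -E.
have [mu muE] := regular_probability cX hX lam0 lamT lam_mono lam_add.
have opre g V : open V -> open (a g @^-1` V).
  by move=> oV; apply: open_comp => // x _; exact: action_continuous.
have cpre g V : closed V -> closed (a g @^-1` V).
  by move=> cV; apply: closed_comp => // x _; exact: action_continuous.
have norm : normal_space X by exact: compact_normal.
have /(@normal_openP R) sep := norm.
have /(@normal_separatorP R) ury := norm.
have inner_le g V : open V -> (inner lam (a g @^-1` V) <= inner lam V)%E.
  move=> oV; apply: ge_ereal_sup => _ [C [cC CV] <-].
  have [||W1 [W2 [oW1 oW2 CW1 VW2 W12]]] := sep C (~` (a g @^-1` V)) cC.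
  - exact/open_closedC/opre.
  - by apply/seteqP; split=> // x [/CV].
  have sepCW : uniform_separator (~` W1) C.
    apply: ury => //; first exact: open_closedC.
    by apply/seteqP; split=> // x [nW /CW1].
  pose f : X -> R := Urysohn (~` W1) C.
  have cf : continuous f by exact: Urysohn_continuous.
  have f01 : unit_valued f.
    move=> x; have : range f (f x) by exists x.
    by move=> /(@Urysohn_range _ R (~` W1) C); rewrite /= in_itv.
  have f1 x : C x -> f x = 1.
    by move=> Cx; apply: (Urysohn_sub1 sepCW); exists x.
  have f0 x : ~ W1 x -> f x = 0.
    by move=> nx; apply: (Urysohn_sub0 sepCW); exists x.
  (* The translate by [g] of the complement of [W2]: a closed subset of [V] outside of which
     [f \o a g^-1] vanishes. *)
  pose C' := a g^-1%g @^-1` (~` W2).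
  apply: (@le_trans _ _ (lam C')%:E); last first.
    apply: lam_le_inner; first by apply: cpre; exact: open_closedC.
    move=> x nW2; rewrite -(actionVK g x).
    by apply: contrapT => nV; apply/nW2/VW2.
  rewrite lee_fin; apply: (@le_trans _ _ (Lm f)).
    apply: Lmono => // x; rewrite indicE.
    by have [/set_mem/f1 ->//|_] := boolP (x \in C); case/andP: (f01 x).
  rewrite -(Linv g^-1%g f cf f01); apply: Lmono => // [x|x]; first exact: f01.
  rewrite indicE; have [_|/negP nC'] := boolP (x \in C').
    by case/andP: (f01 (a g^-1%g x)).
  rewrite /= f0// => W1x; apply: nC'; apply/mem_set => W2x.
  by have : (W1 `&` W2) (a g^-1%g x) by []; rewrite W12.
have outer_le g E : (outer lam (a g @^-1` E) <= outer lam E)%E.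
  apply: le_ereal_inf_tmp => _ [V [oV EV] <-].
  apply: le_trans (inner_le g V oV).
  by apply: outer_le_inner; [exact: opre | exact: preimage_subset].
exists mu => g E _; rewrite !muE; apply/eqP; rewrite eq_le outer_le/=.
(* The reverse inequality is [outer_le] for the inverse of [g]. *)
have {1}-> : E = a g^-1%g @^-1` (a g @^-1` E).
  by apply/funext => x; rewrite /preimage/= actionVK.
exact: outer_le.
Qed.

End invariant_measure.

(** * Amenability of the automorphism group *)

Section automorphisms.
Variables (L : language) (M : structure L).

Lemma autM (g h : Aut M) x : (g * h)%g x = g (h x). Proof. by []. Qed.

Lemma autK (g : Aut M) : cancel g (g^-1)%g.
Proof. by move=> x; rewrite -autM mulVg. Qed.

Lemma autVK (g : Aut M) : cancel (g^-1)%g g.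
Proof. by move=> x; rewrite -autM mulgV. Qed.

(** The sets [B D] generate a filter converging to [g] by [aut_cvgP], hence finer than the
    neighbourhood filter. *)
Lemma nbhs_aut (g : Aut M) (V : set (Aut M)) : nbhs g V ->
  exists2 D : set M, finite_set D &
    forall h : Aut M, (forall x, D x -> h x = g x) -> V h.
Proof.
pose B (D : set M) := [set h : Aut M | forall x, D x -> h x = g x].
have FF : Filter (filter_from finite_set B).
  apply: filter_from_filter; first by exists set0.
  move=> D D' fD fD'; exists (D `|` D'); first by rewrite finite_setU.
  by move=> h hD; split=> x Dx; apply: hD; [left|right].
move=> gV; have [|D fD DV] := (aut_cvgP g FF).2 _ V gV; last by exists D.
move=> x; exists [set x] => // h; exact.
Qed.

End automorphisms.

Section families_to_amenable.
Variables (R : realType) (L : language) (K : smooth_class L) (M : structure L).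
Hypothesis hM : generic K M.

(** Joint continuity gives the bound near each [(x, 1)], and compactness of [X] makes the
    neighbourhood of 1 uniform in [x]. *)
Lemma action_equicontinuous (X : ptopologicalType) (a : Aut M -> X -> X)
    (f : X -> R) (e : R) : compact [set: X] -> continuous_action a ->
  continuous f -> 0 < e ->
  nbhs (1%g : Aut M) [set u | forall x, `|f (a u x) - f x| <= e].
Proof.
move=> /compact_near_coveringP cX [a1 aM ca] cf e0.
have e2 : 0 < e / 2 by rewrite divr_gt0.
have := cX _ (nbhs (1%g : Aut M)) (fun u x => `|f (a u x) - f x| <= e) _.
suff near_e : forall x, [set: X] x ->
    \forall x' \near x & u \near nbhs (1%g : Aut M), `|f (a u x') - f x'| <= e.
  move=> /(_ _ near_e); apply: filterS => u Pu x; exact: Pu.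
move=> x _.
have c1 : {for (x, 1%g : Aut M), continuous (fun y => f (a y.2 y.1))}.
  apply: (@continuous_comp _ _ _ (fun y : X * Aut M => a y.2 y.1) f);
    last exact: cf.
  apply: (@continuous_comp _ _ _ (fun y : X * Aut M => (y.2, y.1))
    (fun y => a y.1 y.2)).
    exact: swap_continuous.
  exact: ca.
have c2 : {for (x, 1%g : Aut M), continuous (fun y => f y.1)}.
  apply: (@continuous_comp _ _ _ (fun y : X * Aut M => y.1) f); last exact: cf.
  exact: cvg_fst.
have n1 := c1 _ (nbhsx_ballx (f (a 1%g x)) _ e2).
have n2 := c2 _ (nbhsx_ballx (f x) _ e2).
have F1 : Filter (nbhs (1%g : Aut M)) by exact: nbhs_filter.
have FP : Filter (filter_prod (nbhs x) (nbhs (1%g : Aut M))).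
  exact: filter_prod_filter.
apply: (@filterS _ _ FP _ _ _ (@filterI _ _ FP _ _ n1 n2)) => -[x' u] [].
by rewrite /= a1 /ball/= !ltr_norml ler_norml; lra.
Qed.

Lemma families_amenable :
  (forall A B, K A -> K B -> leqK K A B -> forall e : R, 0 < e ->
   forall n, exists C, [/\ K C, leqK K B C & forall f : 'I_n -> (A -> C) -> R,
       (forall i G, binom K C A G -> 0 <= f i G <= 1) ->
       exists2 p, measures K C B p & forall i, oscillation_le K (f i) p e]) ->
  amenable R (Aut M).
Proof.
move=> fam X a cX hX aX; apply: invariant_probability => // s e e0 sP.
(* One third of [e] is for the oscillation supplied by [fam], and one for each of two replacements
   of an automorphism by a chosen representative. *)
have [a1 aM _] := aX; have e3 : 0 < e / 3 by rewrite divr_gt0.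
have [D fD DP] : exists2 D : set M, finite_set D & forall u : Aut M,
    (forall x, D x -> u x = x) -> forall x, x \in s ->
    forall y, `|x.2 (a u y) - x.2 y| <= e / 3.
  apply: (@nbhs_aut _ M 1%g).
  apply: (@filter_finite_forall _ _ (nbhs (1%g : Aut M)) [set x | x \in s]
    (fun x => [set u | forall y, `|x.2 (a u y) - x.2 y| <= e / 3])).
    exact: finite_seq.
  move=> x /sP[cx _]; exact: action_equicontinuous.
have [Y sY DY] := strong_cofinal hM fD.
pose A := substructure Y; have bvY := binom_val sY.
have KA : K A by exact: generic_sub hM _ sY.1.
(* [Z] also contains the images of [Y] under the inverses of the group elements of [s]: invariance
   is read off by comparing these copies of [A] in [B] with [A] itself. *)
have [|Z sZ YZ] := @strong_cofinal _ _ _ hM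
    (Y `|` \bigcup_(x in [set x | x \in s]) ((x.1^-1)%g : Aut M) @` Y).
  rewrite finite_setU; split; first exact: sY.1.
  apply: bigcup_finite; first exact: finite_seq.
  by move=> x _; exact/finite_image/sY.1.
pose B := substructure Z; have bvZ := binom_val sZ.
have KB : K B by exact: generic_sub hM _ sZ.1.
have factor (H : A -> M) : binom K M A H -> range H `<=` Z ->
    exists2 g : A -> B, binom K B A g & val \o g = H.
  move=> bH HZ; have [g gE] := corestrict HZ; exists g => //.
  by apply: (binom_factor (@embedding_val _ _ Z)); rewrite gE.
have [|g0 bg0 g0E] := factor val bvY.
  by rewrite range_val => y Yy; apply: YZ; left.
have [C [KC BC ram]] := fam A B KA KB (ex_intro _ g0 bg0) _ e3 (size s).
have [iota biota] := generic_universal hM KC.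
have /choice[h hE] : forall H : A -> M, exists h : Aut M,
    binom K M A H -> h \o val = H.
  move=> H; have [bH|nbH] := pselect (binom K M A H); last by exists 1%g.
  by have [h hH] := homogeneous hM bvY bH; exists h.
have /choice[k kE] : forall l : B -> C, exists k : Aut M,
    binom K C B l -> k \o val = iota \o l.
  move=> l; have [bl|nbl] := pselect (binom K C B l); last by exists 1%g.
  by have [k kl] := homogeneous hM bvZ (binom_comp biota bl); exists k.
pose x0 : X := point.
(* The function [u |-> f(u^-1 x0)], made to depend only on the restriction of [u] to [A] through the
   representative [h]. By [orbE] another representative changes it by at most [e / 3]. *)
pose orb (f : X -> R) (H : A -> M) := f (a (h H)^-1%g x0).
have orbE x (k' : Aut M) H : x \in s -> binom K M A H -> k' \o val = H ->
    `|orb x.2 H - x.2 (a k'^-1%g x0)| <= e / 3.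
  move=> xs bH k'H; pose u : Aut M := ((h H)^-1 * k')%g.
  have := DP u _ x xs (a k'^-1%g x0).
  rewrite -aM /u -mulgA mulgV mulg1; apply => y Dy.
  rewrite autM; pose y' : A := SigSub (mem_set (DY _ Dy)).
  have -> : k' y = h H y.
    by rewrite -[LHS]/((k' \o val) y') -[RHS]/((h H \o val) y') k'H hE.
  exact: autK.
pose sn := tnth (in_tuple s).
have sns i : sn i \in s by exact: mem_tnth.
have /ex_measureP[m mS mosc] := ram (fun i G => orb (sn i).2 (iota \o G))
  (fun i G _ => (sP _ (sns i)).2 _).
exists (fun phi => m (fun l => phi (a (k l)^-1%g x0))).
  exact: fsmean_map mS _.
move=> x xs.
have [gx bgx gxE] : exists2 g : A -> B, binom K B A g &
    val \o g = (x.1^-1)%g \o val.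
  apply: factor.
    apply: binom_iso bvY; exact: aut_iso.
  by move=> _ [y _ <-]; apply: YZ; right; exists x => //;
    exists (val y) => //; exact: (set_mem (valP y)).
have [i iE] : exists i, sn i = x.
  by have /tnthP[i ->] : x \in in_tuple s by []; exists i.
have := mosc i gx g0 bgx bg0; rewrite iE.
have near_gx : `|m (fun l => orb x.2 (iota \o (l \o gx))) -
    m (fun l => x.2 (a x.1 (a (k l)^-1%g x0)))| <= e / 3.
  rewrite -(fsmeanB _ _ mS); apply: (fsmean_norm_le mS) => l bl.
  (* Moving the point [k^-1 x0] by [x.1] amounts to replacing [k] by [k x.1^-1], whose restriction
     to [A] is the copy [gx] placed by [l]. *)
  have -> : a x.1 (a (k l)^-1%g x0) = a (k l * x.1^-1)^-1%g x0.
    by rewrite -aM invgM invgK.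
  apply: orbE => //.
    exact: binom_comp biota (binom_comp bl bgx).
  apply/funext => y; rewrite -[LHS]/(k l (((x.1^-1)%g \o val) y)) -gxE.
  by rewrite -[LHS]/((k l \o val) (gx y)) (kE _ bl).
have near_g0 : `|m (fun l => orb x.2 (iota \o (l \o g0))) -
    m (fun l => x.2 (a (k l)^-1%g x0))| <= e / 3.
  rewrite -(fsmeanB _ _ mS); apply: (fsmean_norm_le mS) => l bl.
  apply: orbE => //; first exact: binom_comp biota (binom_comp bl bg0).
  apply/funext => y; rewrite -[LHS]/(k l ((val : A -> M) y)) -g0E.
  by rewrite -[LHS]/((k l \o val) (g0 y)) (kE _ bl).
by move: near_gx near_g0; rewrite /= !ler_norml; lra.
Qed.

End families_to_amenable.

(** * Orbit closures *)

Section orbit_closure.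
Variables (L : language) (M A : structure L) (b0 : (A -> M) -> bool).

(** Membership in the closure of the orbit of [b0], in a product of two-point spaces, for the action
    [(g b)(H) = b(g^-1 \o H)]. *)
Definition adherent (b : (A -> M) -> bool) := forall E : set (A -> M),
  finite_set E -> exists g : Aut M, forall H, E H -> b H = b0 ((g^-1)%g \o H).

Record orbit_closure := OrbitClosure {
  oc_fun :> (A -> M) -> bool;
  oc_adherent : adherent oc_fun
}.

Lemma oc_ext (x y : orbit_closure) : x =1 y -> x = y.
Proof.
case: x y => [x xa] [y ya] /= /funext xy; rewrite xy in xa *.
by congr OrbitClosure; exact: Prop_irrelevance.
Qed.

Lemma adherent_base : adherent b0.
Proof.
by move=> E _; exists 1%g => H _; rewrite invg1.
Qed.

HB.instance Definition _ := gen_eqMixin orbit_closure.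
HB.instance Definition _ := gen_choiceMixin orbit_closure.
HB.instance Definition _ := isPointed.Build orbit_closure
  (OrbitClosure adherent_base).
HB.instance Definition _ := Topological.copy orbit_closure
  (initial_topology
     (oc_fun : orbit_closure -> {ptws (A -> M) -> discrete_topology bool})).

Lemma oc_cvgP (F : set_system orbit_closure) (x : orbit_closure) : Filter F ->
  F --> x <-> forall H, F [set y : orbit_closure | y H = x H].
Proof.
move=> FF.
have -> : F --> x <->
    ((oc_fun : orbit_closure -> {ptws (A -> M) -> discrete_topology bool}) @ F)
      --> (x : {ptws (A -> M) -> discrete_topology bool}).
  split=> [Fx U Ux|Fx U].
    exact/Fx/(@initial_continuous orbit_closure
      {ptws (A -> M) -> discrete_topology bool}).
  rewrite nbhsE => -[_ [[V oV <-] Vx] VU].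
  apply: filterS VU _; apply: Fx; exact: open_nbhs_nbhs.
have -> : ((oc_fun : orbit_closure ->
      {ptws (A -> M) -> discrete_topology bool}) @ F)
      --> (x : {ptws (A -> M) -> discrete_topology bool}) <->
    forall H, ((fun y : orbit_closure => y H : discrete_topology bool) @ F)
      --> (x H : discrete_topology bool).
  split=> [Fx H|Fx].
    exact: (cvg_comp _ _ Fx (@proj_continuous (A -> M)
      (fun=> discrete_topology bool) H (x : _ -> _))).
  apply/cvg_sup => H U.
  rewrite nbhsE => -[_ [[V oV <-] Vx] VU].
  by apply: filterS VU _; apply: (Fx H); exact: open_nbhs_nbhs.
split=> Fx H; first by have := Fx H; rewrite discrete_cvg.
by rewrite discrete_cvg; exact: Fx.
Qed.

Lemma nbhs_oc (x : orbit_closure) H : nbhs x [set y : orbit_closure | y H = x H].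
Proof. by have /oc_cvgP/(_ H) := @cvg_id _ (nbhs x). Qed.

(** The limit of an ultrafilter is decided coordinate by coordinate. On finitely many coordinates it
    agrees with some member of the closure, hence with a translate of [b0]. *)
Lemma oc_compact : compact [set: orbit_closure].
Proof.
rewrite compact_ultra => U UU _.
pose b H := `[< U [set y : orbit_closure | y H] >].
have bU H : U [set y : orbit_closure | y H = b H].
  rewrite /b; case: asboolP => [UH|nUH]; first exact: (@filterS _ U _ _ _ _ UH).
  have [//|UnH] := in_ultra_setVsetC [set y : orbit_closure | y H] UU.
  by apply: (@filterS _ U _ _ _ _ UnH) => y /= /negP/negbTE.
have ab : adherent b.
  move=> E fE; have UE : U [set y : orbit_closure | forall H, E H -> y H = b H].
    apply: (@filter_finite_forall _ _ U E
      (fun H => [set y : orbit_closure | y H = b H])) => // H _; exact: bU.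
  have [y yb] := filter_ex UE.
  have [g gE] := oc_adherent y fE; exists g => H EH.
  by rewrite -gE// yb.
exists (OrbitClosure ab); split=> //; exact/oc_cvgP.
Qed.

Lemma oc_hausdorff : hausdorff_space orbit_closure.
Proof.
move=> x y xy; apply: oc_ext => H.
by have [z [/= <- <-]] := xy _ _ (nbhs_oc x H) (nbhs_oc y H).
Qed.

Lemma oc_open H : open [set y : orbit_closure | y H].
Proof.
rewrite openE => x xH; apply: filterS (nbhs_oc x H) => y /= ->; exact: xH.
Qed.

Lemma oc_act_adherent (g : Aut M) (x : orbit_closure) :
  adherent (fun H => x ((g^-1)%g \o H)).
Proof.
move=> E fE.
have [h hE] := oc_adherent x (finite_image (fun H : A -> M => (g^-1)%g \o H) fE).
exists (g * h)%g => H EH; rewrite hE; last by exists H.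
by rewrite invgM.
Qed.

Definition oc_act (g : Aut M) (x : orbit_closure) : orbit_closure :=
  OrbitClosure (oc_act_adherent g x).

Lemma oc_act_continuous : finite_structure A -> continuous_action oc_act.
Proof.
move=> fA; split.
- move=> x; apply: oc_ext => H; rewrite -[LHS]/(x ((1^-1 : Aut M)%g \o H)).
  by rewrite invg1.
- move=> g h x; apply: oc_ext => H.
  by rewrite -[LHS]/(x (((g * h)^-1)%g \o H)) invgM.
move=> [g x].
have Fg : Filter (nbhs (g : Aut M)) by exact: nbhs_filter.
have Fx : Filter (nbhs (x : orbit_closure)) by exact: nbhs_filter.
apply/(@oc_cvgP _ _ (fmap_filter _ (filter_prod_filter Fg Fx))) => H.
(* As [A] is finite, [h] may be required to agree with [g] on all [g^-1 (H a)]. Then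
   [h^-1 \o H = g^-1 \o H], and a single coordinate of [x] is involved. *)
exists ([set h : Aut M | forall a : A, [set: A] a ->
      h ((g^-1)%g (H a)) = g ((g^-1)%g (H a))],
    [set y : orbit_closure | y ((g^-1)%g \o H) = x ((g^-1)%g \o H)]).
  split; last exact: nbhs_oc.
  apply: (@filter_finite_forall _ _ (nbhs (g : Aut M)) [set: A] (fun a =>
    [set h : Aut M | h ((g^-1)%g (H a)) = g ((g^-1)%g (H a))])) => // a _.
  by have /aut_cvgP/(_ ((g^-1)%g (H a))) := @cvg_id _ (nbhs g).
move=> [h y] /= [hg <-]; congr (oc_fun y); apply/funext => a.
rewrite -[LHS]/((h^-1)%g (H a)) -[RHS]/((g^-1)%g (H a)).
by apply: (can_inj (autK h)); rewrite autVK hg// autVK.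
Qed.

End orbit_closure.

Lemma measure_finite_partition (R : realType) (d : measure_display)
    (T : measurableType d)
    (mu : probability T R) (I : finType) (S : I -> set T) (D : set T) :
  (forall i, measurable (S i)) -> measurable D ->
  (forall t, exists i, S i t) ->
  (forall i j t, S i t -> S j t -> i = j) ->
  \sum_i fine (mu (D `&` S i)) = fine (mu D).
Proof.
move=> mS mD cover disj.
have mDS i : measurable (D `&` S i) by exact: measurableI.
have {2}-> : D = \bigcup_(i in [set: I]) (D `&` S i).
  apply/seteqP; split=> [t Dt|t [i _ []]//].
  by have [i Sit] := cover t; exists i.
rewrite measure_fin_bigcup//; last 2 first.
- exact: finite_finset.
- by move=> i j _ _ [t [[_ Si] [_ Sj]]]; exact: disj Si Sj.
rewrite (fsbigE (enum I)) ?enum_uniq//; last first.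
  by move=> i _; rewrite mem_enum.
rewrite sum_fine; last by move=> i _; exact: fin_num_measure.
rewrite big_enum_cond/=; congr fine; apply: eq_bigl => i.
by rewrite in_setT.
Qed.

(** * From an invariant measure to the convex Ramsey property *)

Section amenable_to_Ramsey.
Variables (R : realType) (L : language) (K : smooth_class L) (M : structure L).
Hypothesis hM : generic K M.

Lemma amenable_convex_Ramsey : amenable R (Aut M) -> convex_Ramsey K R M.
Proof.
move=> amen A B KA KB AB f f01.
have fA := sc_finite K KA.
pose b0 (H : A -> M) := f H == 1.
have [mu muinv] := amen (orbit_closure b0) (@oc_act _ _ _ b0)
  (@oc_compact _ _ _ b0) (@oc_hausdorff _ _ _ b0) (oc_act_continuous b0 fA).
pose T := g_sigma_algebraType (@open (orbit_closure b0)).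
pose cyl (H : A -> M) : set T := [set y : orbit_closure b0 | y H].
have mcyl H : measurable (cyl H).
  by apply: sub_sigma_algebra; exact: oc_open.
have mu_cyl H1 H2 : binom K M A H1 -> binom K M A H2 -> mu (cyl H1) = mu (cyl H2).
  move=> b1 b2; have [g gH] := homogeneous hM b1 b2.
  rewrite -(muinv g (cyl H2) (mcyl H2)); congr (mu _).
  apply/seteqP; split=> y; rewrite /cyl /preimage/= (_ : _ \o H2 = H1)//;
    by rewrite -gH; apply/funext => a; exact: autK.
have [j0 bj0] := generic_universal hM KB.
have /finite_seqP[s sE] := finite_binom KA KB.
pose n := size s; pose sn : 'I_n -> (A -> B) := tnth (in_tuple s).
have sn_binom i : binom K B A (sn i) by rewrite sE; exact: mem_tnth.
(* The atoms of the finite algebra generated by the cylinders at the copies of [A] inside the copy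
   [j0] of [B]. *)
pose S (p : {ffun 'I_n -> bool}) : set T :=
  [set y : orbit_closure b0 | forall i, y (j0 \o sn i) = p i].
have mS p : measurable (S p).
  have -> : S p = \bigcap_(i in [set: 'I_n])
      (if p i then cyl (j0 \o sn i) else ~` cyl (j0 \o sn i)).
    apply/seteqP; split=> [y Sy i _|y Sy i].
      by have := Sy i; case: (p i) => //= /negbT/negP.
    by have := Sy i I; case: (p i) => //= /negP/negbTE.
  apply: fin_bigcap_measurable; first exact: finite_finset.
  by move=> i _; case: (p i) => //; exact: measurableC.
(* By adherence, every pattern that occurs is realized by a translate of the colouring; the others
   have weight zero and get the default 1. *)
have /choice[g gP] : forall p, exists g : Aut M, S p !=set0 ->
    forall i, b0 ((g^-1)%g \o (j0 \o sn i)) = p i.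
  move=> p; have [[y Spy]|nS] := pselect (S p !=set0); last by exists 1%g.
  have [|g gE] := oc_adherent y (E := range (fun i => j0 \o sn i)).
    exact/finite_image/finite_finset.
  by exists g => _ i; rewrite -gE ?Spy//; exists i.
pose w p := fine (mu (S p)).
have w0 p : 0 <= w p by exact/fine_ge0/measure_ge0.
have part D : measurable D -> \sum_p fine (mu (D `&` S p)) = fine (mu D).
  move=> mD; apply: measure_finite_partition => //.
    move=> y; exists [ffun i => (y : orbit_closure b0) (j0 \o sn i)] => i.
    by rewrite ffunE.
  by move=> p q y Sp Sq; apply/ffunP => i; rewrite -(Sp i) -(Sq i).
have w1 : \sum_p w p = 1.
  have := part setT measurableT; rewrite probability_setT/= => <-.
  by apply: eq_bigr => p _; rewrite setTI.
pose m phi := \sum_p w p * phi ((g p)^-1%g \o j0).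
apply/ex_measure1P; exists m.
  exists {ffun 'I_n -> bool}, w, (fun p => (g p)^-1%g \o j0); split=> // p.
  exact: binom_iso (aut_iso _) bj0.
(* On each nonempty atom, [f] takes the value [p i] at the chosen copy, so the mean sums the masses
   of the atoms inside the cylinder. All cylinders have equal mass, whence oscillation zero. *)
have mE i : m (fun l => f (l \o sn i)) = fine (mu (cyl (j0 \o sn i))).
  rewrite -(part _ (mcyl _)); apply: eq_bigr => p _.
  have [S0|/set0P nS] := eqVneq (S p) set0.
    by rewrite /w S0 setI0 measure0 mul0r.
  have := gP p nS i; rewrite /b0.
  have bH : binom K M A ((g p)^-1%g \o (j0 \o sn i)).
    exact/(binom_iso (aut_iso _))/(binom_comp bj0).
  have -> : ((g p)^-1%g \o j0) \o sn i = (g p)^-1%g \o (j0 \o sn i) by [].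
  have [->|->] := f01 _ bH.
    rewrite eq_sym oner_eq0 mulr0 => pi.
    rewrite (_ : _ `&` _ = set0) ?measure0//.
    by apply/seteqP; split=> // y [cy /(_ i)]; rewrite -pi; move: cy => /= ->.
  rewrite eqxx mulr1 => pi; rewrite (_ : _ `&` _ = S p)//.
  by apply/setIidPr => y /(_ i); rewrite -pi.
move=> g1 g2 Bg1 Bg2.
have idx g' : binom K B A g' -> exists i, g' = sn i.
  by rewrite sE => g's; apply/(tnthP (in_tuple s)).
have [i ->] := idx _ Bg1; have [j ->] := idx _ Bg2.
rewrite !mE (mu_cyl _ (j0 \o sn j)) ?subrr ?normr0 ?divr_ge0//.
  exact: binom_comp bj0 (sn_binom _).
exact: binom_comp bj0 (sn_binom _).
Qed.

End amenable_to_Ramsey.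

Theorem theorem3p7 (R : realType) (L : language) (K : smooth_class L)
    (M : structure L) (hHP : hereditary K) (hAP : amalgamation K)
    (hM : generic K M) :
  [<-> (* (1) *)
       convex_Ramsey K R M;
       (* (2) *)
       forall A B : structure L, K A -> K B -> leqK K A B ->
       exists C : structure L, [/\ K C, leqK K B C &
         forall f : (A -> C) -> R,
           (forall G, binom K C A G -> f G = 0 \/ f G = 1) ->
         exists2 p, measures K C B p & oscillation_le K f p (1 / 2)];
       (* (3) *)
       forall A B : structure L, K A -> K B -> leqK K A B ->
       forall e : R, 0 < e ->
       exists C : structure L, [/\ K C, leqK K B C &
         forall f : (A -> C) -> R,
           (forall G, binom K C A G -> 0 <= f G <= 1) ->
         exists2 p, measures K C B p & oscillation_le K f p e];
       (* (4) *)
       forall A B : structure L, K A -> K B -> leqK K A B ->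
       forall e : R, 0 < e -> forall n : nat,
       exists C : structure L, [/\ K C, leqK K B C &
         forall f : 'I_n -> (A -> C) -> R,
           (forall i G, binom K C A G -> 0 <= f i G <= 1) ->
         exists2 p, measures K C B p &
           forall i, oscillation_le K (f i) p e];
       (* (5) *)
       amenable R (Aut M)].
Proof.
tfae.
- exact: convex_Ramsey_finite.
- exact: binary_to_unit_interval.
- exact: unit_interval_to_finite_families.
- exact: families_amenable.
- exact: amenable_convex_Ramsey.
Qed.
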